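(* Let $\mathcal R=(U,\mathsf E_{\mathcal R},\mathscr H_{\mathcal R})$ be a localizable $\mu$-admissible principal groupoid quantum reference frame for a continuous groupoid $\Gamma\rightrightarrows M$ whose target fibres $\Gamma^x$ are metrizable, and let $\mathcal S=(\mathscr H_{\mathcal S},V)$ be a system over $M$. Suppose there is $x\in M$ with $1_x\in\mathrm{supp}\,\mathsf E^x_{\mathcal R}$, and that $(\omega_n^x)_n$ is a localizing sequence of density operators on $\mathcal H^x_{\mathcal R}$ centred at $1_x$, with $\omega_n=(\omega_n^x)\in\mathscr S(\mathscr H_{\mathcal R})$. Then for any $A\in\mathcal A(\mathscr H_{\mathcal S})_{\mathrm{uw}}$, $$\lim_{n\to\infty}\mathrm{Rel}^{\mathcal R}_{\omega_n}(A)_x=A_x$$ ultraweakly in $\mathcal B(\mathcal H^x_{\mathcal S})$. Moreover, assume that there exists a sequence of measurable fibre-state sections $\omega_n=(\omega_n^x)\in\mathscr S(\mathscr H_{\mathcal R})$ such that $\mu^{\mathsf E^x_{\mathcal R}}_{\omega_n^x}\to\delta_{1_x}$ weakly for $\mu$-almost every $x$. Then for any $A\in\mathcal A(\mathscr H_{\mathcal S})_{\mathrm{uw}}$, $\mathrm{Rel}^{\mathcal R}_{\omega_n}(A)\to A$ ultraweakly, i.e. in the topology $\sigma(\mathcal A(\mathscr H_{\mathcal S}),\mathcal A(\mathscr H_{\mathcal S})_* )$.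
   Context: **Groupoids.** A continuous groupoid $\Gamma\rightrightarrows M$ has topological spaces $\Gamma$ (arrows), $M$ (objects), continuous source/target maps $s,t$, units $x\mapsto1_x$, inversion, and composition $\alpha\circ\beta$ defined when $s(\alpha)=t(\beta)$. $\Gamma^x:=t^{-1}(x)$; $L_\alpha:\Gamma^{s(\alpha)}\to\Gamma^{t(\alpha)}$, $L_\alpha\beta=\alpha\circ\beta$. Standing assumptions: $\Gamma$ is second countable Hausdorff with a continuous left Haar system $\{\nu^x\}$ (positive Radon measures on $\Gamma^x$ of full support, continuous in $x$, with $(L_\alpha)_*\nu^{s(\alpha)}=\nu^{t(\alpha)}$); $\mu$ is a $\sigma$-finite quasi-invariant Radon measure on $M$ ($\int_M\nu^xd\mu(x)$ is mutually absolutely continuous with its image under inversion). **Fields.** Hilbert spaces are complex separable. For a continuous field $\mathscr H=\bigsqcup_x\mathcal H^x$ over $M$, $\mathcal A(\mathscr H)=\int^\oplus_M\mathcal B(\mathcal H^x)d\mu(x)$ is the von Neumann algebra of essentially bounded measurable operator fields mod a.e. equality; its predual $\mathcal A(\mathscr H)_*$ consists of measurable fields $\chi_x\in\mathcal T(\mathcal H^x)$ with $\int_M\|\chi_x\|_1d\mu<\infty$, paired by $\int_M\mathrm{Tr}[A_x\chi_x]d\mu(x)$. $\mathscr S(\mathscr H)$: fields $\omega=(\omega_x)\in\mathcal A(\mathscr H)$ with $\omega_x$ a density operator a.e. $\mathcal A(\mathscr H)_{\mathrm{uw}}$: bounded fields $A=(A_x)$ such that $x\mapsto\mathrm{Tr}[\chi_xA_x]$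 is continuous for every trace-norm continuous section $x\mapsto\chi_x\in\mathcal T(\mathcal H^x)$. A unitary representation $U$ of $\Gamma$ on $\mathscr H$ is a measurable assignment of unitaries $U_\alpha:\mathcal H^{s(\alpha)}\to\mathcal H^{t(\alpha)}$ with $U_{\alpha\circ\beta}=U_\alpha U_\beta$, $U_{1_x}=\mathbb 1$. It is fibre-wise ultraweakly continuous if $\alpha\mapsto\mathrm{Tr}[U_\alpha\chi_\alpha]$ is continuous for every field $\chi_\alpha\in\mathcal T(\mathcal H^{t(\alpha)},\mathcal H^{s(\alpha)})$ that is locally a trace-norm uniform limit of finite-rank fields $\sum_j|\xi^j_{s(\alpha)}\rangle\langle\eta^j_{t(\alpha)}|$ with $\xi^j,\eta^j$ continuous sections. A system over $M$ is $\mathcal S=(\mathscr H_{\mathcal S},V)$: a continuous field of Hilbert spaces with a fibre-wise ultraweakly continuous unitary representation $V$ of $\Gamma$. **Frames.** A (principal) groupoid quantum reference frame $\mathcal R=(U,\mathsf E_{\mathcal R},\mathscr H_{\mathcal R})$: a continuous field $\mathscr H_{\mathcal R}$, a fibre-wise ultraweakly continuous unitary representation $U$ of $\Gamma$ on it, and a family of normalized POVMs $\mathsf E^x_{\mathcal R}:\mathrm{Bor}(\Gamma^x)\to\mathcal E(\mathcal H^x_{\mathcal R})$, measurable ($x\mapsto\mathsf E^x_{\mathcal R}(\Delta\cap\Gamma^x)$ measurable for all $\Delta\in\mathrm{Bor}(\Gamma)$) and covariant: $U_\alpha\mathsf E^{s(\alpha)}_{\mathcal R}(\Delta)U_\alpha^\dagger=\mathsf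 E^{t(\alpha)}_{\mathcal R}(L_\alpha\Delta)$. $\mu$-admissible: for $\mu$-a.e. $x$, $\mu(N)=0\Rightarrow\mathsf E^x_{\mathcal R}(s^{-1}(N)\cap\Gamma^x)=0$. Localizable: $\|\mathsf E^x_{\mathcal R}(\Delta)\|=1$ whenever $\mathsf E^x_{\mathcal R}(\Delta)\neq0$. $\mu^{\mathsf E^x_{\mathcal R}}_{\omega_x}(\Delta):=\mathrm{Tr}[\omega_x\mathsf E^x_{\mathcal R}(\Delta)]$; $\mathrm{supp}\,\mathsf E^x_{\mathcal R}:=\bigcup_{\omega_x}\mathrm{supp}\,\mu^{\mathsf E^x_{\mathcal R}}_{\omega_x}$ over density operators. A localizing sequence centred at $\beta\in\Gamma^x$ is a sequence of density operators $\omega^x_n$ with $\mu^{\mathsf E^x_{\mathcal R}}_{\omega^x_n}\to\delta_\beta$ weakly. **Restricted relativization.** $\mathrm{Rel}^{\mathcal R}_\omega(A)_x:=\int_{\Gamma^x}V_\beta A_{s(\beta)}V_\beta^\dagger\,d\mu^{\mathsf E^x_{\mathcal R}}_{\omega_x}(\beta)$ (ultraweak integral) and $\mathrm{Rel}^{\mathcal R}_\omega(A):=\int^\oplus_M\mathrm{Rel}^{\mathcal R}_\omega(A)_xd\mu(x)\in\mathcal A(\mathscr H_{\mathcal S})$. *)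

(* Defs.v *)
From HB Require Import structures.
From mathcomp Require Import all_boot all_order all_algebra complex.
From mathcomp Require Import all_classical all_reals all_analysis.

Set Implicit Arguments.
Unset Strict Implicit.
Unset Printing Implicit Defensive.

Import Order.TTheory GRing.Theory Num.Theory.
Import numFieldNormedType.Exports.

Local Open Scope classical_set_scope.
Local Open Scope ring_scope.

(* R[i] carries no topology in the libraries; as every numeric field of
   MathComp-Analysis, it is given the one of its modulus. *)
#[non_forgetful_inheritance]
HB.instance Definition _ (R : realType) := GRing.ComAlgebra.copy R[i] R[i]^o.
#[non_forgetful_inheritance]
HB.instance Definition _ (R : realType) := Vector.copy R[i] R[i]^o.
#[non_forgetful_inheritance]
HB.instance Definition _ (R : realType) := NormedModule.copy R[i] R[i]^o.

Notation borel T := (g_sigma_algebraType (@open T)).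

(* Complex Hilbert spaces; the inner product is conjugate-linear in its first
   argument.  The norm of a normed module over R[i] takes its values in R[i]. *)
HB.mixin Record CompleteNormedModule_isHilbert (R : realType) V
    of CompleteNormedModule R[i] V := {
  inner : V -> V -> R[i] ;
  inner_scalar : forall u : V, scalar (inner u) ;
  inner_conj : forall u v : V, inner v u = ((inner u v)^*)%C ;
  inner_norm : forall u : V, inner u u = `|u| ^+ 2
}.

#[short(type="hilbertType")]
HB.structure Definition Hilbert (R : realType) :=
  { V of CompleteNormedModule_isHilbert R V & CompleteNormedModule R[i] V }.

Section Operators.
Context {R : realType}.
Implicit Types H K L : hilbertType R.

Definition op_bounded_by H K (C : R) (T : H -> K) :=
  forall v, `|T v| <= (C%:C)%C * `|v|.

Definition bounded_op H K (T : H -> K) :=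
  linear T /\ exists C, op_bounded_by C T.

Definition opnorm H K (T : H -> K) : R :=
  sup [set complex.Re `|T v| | v in [set v : H | `|v| <= 1]].

Definition adjoint H K (T : H -> K) : K -> H :=
  xget (fun=> 0) [set S | forall w v, inner (S w) v = inner w (T v)].

Definition unitary H K (T : H -> K) :=
  [/\ linear T, forall v w, inner (T v) (T w) = inner v w
    & forall w, exists v, T v = w].

Definition positive_op H (T : H -> H) := forall v, 0 <= inner v (T v).

Definition effect H (T : H -> H) :=
  [/\ bounded_op T, positive_op T & positive_op (fun v => v - T v)].

(* Zero vectors are allowed in the sequence, so that finite-dimensional spaces
   have orthonormal bases too. *)
Definition orthonormal_basis H (e : nat -> H) :=
  [/\ forall i, e i = 0 \/ `|e i| = 1,
      forall i j, i != j -> inner (e i) (e j) = 0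
    & forall v, (forall i, inner (e i) v = 0) -> v = 0].

(* An arbitrary choice; traces and trace norms of trace-class operators do not
   depend on it. *)
Definition chosen_basis H : nat -> H := xget (fun=> 0) (@orthonormal_basis H).

Definition trace H (T : H -> H) : R[i] :=
  limn (series (fun i => inner (chosen_basis H i) (T (chosen_basis H i)))).

(* P is the modulus |T|, the positive square root of T^* T. *)
Definition is_modulus H K (T : H -> K) (P : H -> H) :=
  [/\ bounded_op P, positive_op P & forall v, P (P v) = adjoint T (T v)].

Definition modulus H K (T : H -> K) : H -> H := xget (fun=> 0) (is_modulus T).

Definition trnorm H K (T : H -> K) : \bar R :=
  (\sum_(i <oo)
     (complex.Re (inner (chosen_basis H i) (modulus T (chosen_basis H i))))%:E)%E.

Definition trace_class H K (T : H -> K) :=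
  [/\ bounded_op T, is_modulus T (modulus T) & (trnorm T < +oo)%E].

Definition density H (w : H -> H) :=
  [/\ trace_class w, positive_op w & trace w = 1].

Definition ketbra H K (u : K) (v : H) : H -> K := fun z => inner v z *: u.

Definition op_uw_cvg H (T_ : nat -> H -> H) (T : H -> H) :=
  [/\ forall n, bounded_op (T_ n), bounded_op T
    & forall chi : H -> H, trace_class chi ->
        trace (chi \o T_ n) @[n --> \oo] --> trace (chi \o T)].

End Operators.

Section Measures.
Context {R : realType} {T : ptopologicalType}.
Implicit Types m : {measure set (borel T) -> \bar R}.

Definition cmeasurable (f : T -> R[i]) :=
  measurable_fun [set: borel T] (fun y => complex.Re (f y)) /\
  measurable_fun [set: borel T] (fun y => complex.Im (f y)).

(* measurability with respect to the completion of m *)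
Definition ae_cmeasurable m (f : T -> R[i]) :=
  exists g, cmeasurable g /\ {ae m, forall y, f y = g y}.

Definition cintegrable m (D : set T) (f : T -> R[i]) :=
  m.-integrable D (fun y => (complex.Re (f y))%:E) /\
  m.-integrable D (fun y => (complex.Im (f y))%:E).

Definition cintegral m (D : set T) (f : T -> R[i]) : R[i] :=
  ((\int[m]_(y in D) complex.Re (f y)) +i*
   (\int[m]_(y in D) complex.Im (f y)))%C.

(* A measure on a Borel subset D of T is represented by a measure on T carried
   by D. *)
Definition carried_by (D : set T) m := m (~` D) = 0%E.

Definition radon_on (D : set T) m :=
  [/\ carried_by D m,
      forall y, D y -> exists U, [/\ open U, U y & (m U < +oo)%E]
    & forall B, measurable (B : set (borel T)) -> B `<=` D ->
        m B = ereal_sup [set m K | K in [set K | compact K /\ K `<=` B]]].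

Definition support_on (D : set T) m : set T :=
  [set y | D y /\ forall U, open U -> U y -> (0 < m (U `&` D))%E].

Definition weak_cvg_on (D : set T) (m_ : nat -> {measure set (borel T) -> \bar R})
    m :=
  forall f : T -> R, {within D, continuous f} ->
    (exists C, forall y, D y -> `|f y| <= C) ->
    (\int[m_ n]_(y in D) f y) @[n --> \oo] --> \int[m]_(y in D) f y.

End Measures.

Definition metrizable_on (R : realType) (T : ptopologicalType) (D : set T) :=
  exists d : T -> T -> R,
    [/\ forall y z, D y -> D z -> 0 <= d y z /\ (d y z = 0 <-> y = z),
        forall y z, D y -> D z -> d y z = d z y,
        forall x y z, D x -> D y -> D z -> d x z <= d x y + d y z
      & forall (y : T) (W : set T), D y ->
          nbhs (y : subspace D) W <->
          exists2 e, 0 < e & [set z | D z /\ d y z < e] `<=` W].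

(* The composition is a total function, only meaningful on composable pairs. *)
Record groupoid (Gm M : ptopologicalType) := Groupoid {
  src : Gm -> M ;
  tgt : Gm -> M ;
  gid : M -> Gm ;
  ginv : Gm -> Gm ;
  gcomp : Gm -> Gm -> Gm ;
  src_id : forall x, src (gid x) = x ;
  tgt_id : forall x, tgt (gid x) = x ;
  src_inv : forall a, src (ginv a) = tgt a ;
  tgt_inv : forall a, tgt (ginv a) = src a ;
  src_comp : forall a b, src a = tgt b -> src (gcomp a b) = src b ;
  tgt_comp : forall a b, src a = tgt b -> tgt (gcomp a b) = tgt a ;
  gcompA : forall a b c, src a = tgt b -> src b = tgt c ->
    gcomp a (gcomp b c) = gcomp (gcomp a b) c ;
  gcomp1g : forall a, gcomp (gid (tgt a)) a = a ;
  gcompg1 : forall a, gcomp a (gid (src a)) = a ;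
  gcompVg : forall a, gcomp (ginv a) a = gid (src a) ;
  gcompgV : forall a, gcomp a (ginv a) = gid (tgt a) ;
  src_continuous : continuous src ;
  tgt_continuous : continuous tgt ;
  gid_continuous : continuous gid ;
  ginv_continuous : continuous ginv ;
  gcomp_continuous : {within [set p : Gm * Gm | src p.1 = tgt p.2],
    continuous (fun p : Gm * Gm => gcomp p.1 p.2)}
}.

Section Groupoids.
Context {R : realType} {Gm M : ptopologicalType} (G : groupoid Gm M).

Definition tfiber (x : M) : set Gm := [set b | tgt G b = x].

Definition haar_system (nu : M -> {measure set (borel Gm) -> \bar R}) :=
  [/\ forall x, radon_on (tfiber x) (nu x),
      forall x, support_on (tfiber x) (nu x) = tfiber x,
      forall f : Gm -> R, continuous f ->
        (exists K : set Gm, compact K /\ forall b, ~ K b -> f b = 0) ->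
        continuous (fun x => \int[nu x]_(b in tfiber x) f b)
    & forall (a : Gm) (D : set Gm), measurable (D : set (borel Gm)) ->
        D `<=` tfiber (tgt G a) ->
        nu (tgt G a) D = nu (src G a) (tfiber (src G a) `&` gcomp G a @^-1` D)].

Definition quasi_invariant (nu : M -> {measure set (borel Gm) -> \bar R})
    (mu : {measure set (borel M) -> \bar R}) :=
  forall D : set Gm, measurable (D : set (borel Gm)) ->
    (\int[mu]_x nu x D = 0 <-> \int[mu]_x nu x (ginv G @^-1` D) = 0)%E.

End Groupoids.

(* Dixmier's axioms, for fields of separable spaces: hfield_fundamental provides
   a fundamental sequence of continuous sections, through which the field is
   also a measurable field, and contains Dixmier's totality axiom. *)
Record hfield (R : realType) (M : ptopologicalType) := HField {
  fiber :> M -> hilbertType R ;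
  csection : set (forall x, fiber x) ;
  csectionD : forall xi eta, csection xi -> csection eta ->
    csection (fun x => xi x + eta x) ;
  csectionZ : forall (c : R[i]) xi, csection xi ->
    csection (fun x => c *: xi x) ;
  csection_norm : forall xi, csection xi -> continuous (fun x => `|xi x|) ;
  csection_local : forall xi : forall x, fiber x,
    (forall (x0 : M) (e : R), 0 < e -> exists2 zeta, csection zeta &
       \forall x \near x0, `|xi x - zeta x| <= (e%:C)%C) ->
    csection xi ;
  hfield_fundamental : exists zeta : nat -> forall x, fiber x,
    (forall k, csection (zeta k)) /\
    forall x (v : fiber x) (e : R), 0 < e ->
      exists (n : nat) (c : 'I_n -> R[i]),
        `|v - \sum_(k < n) c k *: zeta k x| <= (e%:C)%C
}.

Section Fields.
Context {R : realType} {M : ptopologicalType}.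
Implicit Types (H : hfield R M) (mu : {measure set (borel M) -> \bar R}).

Definition transport H (x y : M) (e : x = y) : H x -> H y :=
  fun v => eq_rect x (fun z => H z : Type) v y e.

Definition op_field H := forall x : M, H x -> H x.

Definition measurable_op_field H (A : op_field H) :=
  forall xi eta, csection xi -> csection eta ->
    cmeasurable (fun x => inner (xi x) (A x (eta x))).

Definition ae_measurable_op_field mu H (A : op_field H) :=
  forall xi eta, csection xi -> csection eta ->
    ae_cmeasurable mu (fun x => inner (xi x) (A x (eta x))).

(* A represents an element of the von Neumann algebra of the field. *)
Definition vn_algebra mu H (A : op_field H) :=
  [/\ forall x, bounded_op (A x), ae_measurable_op_field mu A
    & exists C, {ae mu, forall x, op_bounded_by C (A x)}].

Definition vn_predual mu H (chi : op_field H) :=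
  [/\ forall x, trace_class (chi x), ae_measurable_op_field mu chi
    & exists g : M -> R, mu.-integrable [set: borel M] (EFin \o g) /\
        {ae mu, forall x, trnorm (chi x) = (g x)%:E}].

Definition vn_states mu H (w : op_field H) :=
  vn_algebra mu w /\ {ae mu, forall x, density (w x)}.

(* convergence in the topology of the pairing of the algebra and its predual *)
Definition vn_uw_cvg mu H (A_ : nat -> op_field H) (A : op_field H) :=
  [/\ forall n, vn_algebra mu (A_ n), vn_algebra mu A
    & forall chi : op_field H, vn_predual mu chi ->
        cintegral mu setT (fun x => trace (A_ n x \o chi x)) @[n --> \oo] -->
        cintegral mu setT (fun x => trace (A x \o chi x))].

(* The fields sum_j |xi^j_(p y)><eta^j_(q y)| over a space Y, for continuous
   sections xi^j and eta^j. *)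
Definition finite_rank_field H (Y : Type) (p q : Y -> M)
    (F : forall y, H (q y) -> H (p y)) :=
  exists (n : nat) (xi eta : 'I_n -> forall x, H x),
    (forall j, csection (xi j) /\ csection (eta j)) /\
    forall y v, F y v = \sum_(j < n) ketbra (xi j (p y)) (eta j (q y)) v.

Definition trnorm_close H (Y : Type) (p q : Y -> M) (W : set Y) (e : R)
    (chi F : forall y, H (q y) -> H (p y)) :=
  forall y, W y -> (trnorm (fun v => (chi y v - F y v)%R) <= e%:E)%E.

(* Continuity in the field of trace classes, generated by finite-rank fields. *)
Definition trnorm_continuous H (chi : op_field H) :=
  (forall x, trace_class (chi x)) /\
  forall (x0 : M) (e : R), 0 < e -> exists (W : set M) (F : op_field H),
    [/\ nbhs x0 W, finite_rank_field (p := id) (q := id) F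
      & trnorm_close (p := id) (q := id) W e chi F].

Definition locally_uniform_limit_of_finite_rank H (Y : topologicalType)
    (p q : Y -> M) (chi : forall y, H (q y) -> H (p y)) :=
  forall y0 : Y, exists2 W, nbhs y0 W &
    forall e : R, 0 < e -> exists2 F : forall y, H (q y) -> H (p y),
      finite_rank_field F & trnorm_close W e chi F.

Definition uw_continuous H (A : op_field H) :=
  [/\ forall x, linear (A x), exists C, forall x, op_bounded_by C (A x)
    & forall chi : op_field H, trnorm_continuous chi ->
        continuous (fun x => trace (chi x \o A x))].

End Fields.

Record urep (R : realType) (Gm M : ptopologicalType) (G : groupoid Gm M)
    (H : hfield R M) := URep {
  urep_op :> forall a : Gm, H (src G a) -> H (tgt G a) ;
  urep_unitary : forall a, unitary (@urep_op a) ;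
  urep_measurable : forall xi eta : forall x, H x,
    csection xi -> csection eta ->
    cmeasurable (fun a => inner (eta (tgt G a)) (@urep_op a (xi (src G a)))) ;
  urep_id : forall x (v : H x),
    @urep_op (gid G x) (transport (esym (src_id G x)) v) =
    transport (esym (tgt_id G x)) v ;
  urep_comp : forall a b (ab : src G a = tgt G b) (v : H (src G b)),
    @urep_op (gcomp G a b) (transport (esym (src_comp ab)) v) =
    transport (esym (tgt_comp ab))
      (@urep_op a (transport (esym ab) (@urep_op b v)))
}.

Arguments urep_op {R Gm M G H} U a _ : rename.

Definition urep_uw_continuous (R : realType) (Gm M : ptopologicalType)
    (G : groupoid Gm M) (H : hfield R M) (U : urep G H) :=
  forall chi : forall a : Gm, H (tgt G a) -> H (src G a),
    (forall a, trace_class (chi a)) ->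
    locally_uniform_limit_of_finite_rank chi ->
    continuous (fun a : Gm => trace (U a \o chi a)).

Record gsystem (R : realType) (Gm M : ptopologicalType) (G : groupoid Gm M) :=
  GSystem {
  sys_field : hfield R M ;
  sys_rep : urep G sys_field ;
  sys_rep_continuous : urep_uw_continuous sys_rep
}.

(* E x D is only meaningful for the Borel sets D of Gm contained in the target
   fibre of x, which are the Borel sets of this fibre. *)
Record qrf (R : realType) (Gm M : ptopologicalType) (G : groupoid Gm M) := QRF {
  qrf_field : hfield R M ;
  qrf_rep : urep G qrf_field ;
  qrf_rep_continuous : urep_uw_continuous qrf_rep ;
  qrf_povm : forall x : M, set Gm -> qrf_field x -> qrf_field x ;
  povm_effect : forall x (D : set Gm), measurable (D : set (borel Gm)) ->
    D `<=` tfiber G x -> effect (@qrf_povm x D) ;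
  povm_normalized : forall x v, @qrf_povm x (tfiber G x) v = v ;
  povm_sigma_additive : forall x (D : nat -> set Gm),
    (forall k, measurable (D k : set (borel Gm)) /\ D k `<=` tfiber G x) ->
    trivIset setT D -> forall v w,
    series (fun k => inner v (@qrf_povm x (D k) w)) @ \oo -->
    inner v (@qrf_povm x (\bigcup_k D k) w) ;
  povm_measurable : forall D : set Gm, measurable (D : set (borel Gm)) ->
    measurable_op_field (fun x => @qrf_povm x (D `&` tfiber G x)) ;
  povm_covariant : forall (a : Gm) (D : set Gm),
    measurable (D : set (borel Gm)) -> D `<=` tfiber G (src G a) ->
    forall v, qrf_rep a (@qrf_povm (src G a) D (adjoint (qrf_rep a) v)) =
              @qrf_povm (tgt G a) (gcomp G a @` D) v
}.

Arguments qrf_povm {R Gm M G} F x D _ : rename.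

Section Frames.
Context {R : realType} {Gm M : ptopologicalType} {G : groupoid Gm M}.
Implicit Types (F : qrf R G) (S : gsystem R G).

Definition admissible (mu : {measure set (borel M) -> \bar R}) F :=
  {ae mu, forall x, forall N : set M, measurable (N : set (borel M)) ->
     mu N = 0%E ->
     qrf_povm F x (src G @^-1` N `&` tfiber G x) = (fun=> 0)}.

Definition localizable F :=
  forall x (D : set Gm), measurable (D : set (borel Gm)) ->
    D `<=` tfiber G x -> qrf_povm F x D <> (fun=> 0) ->
    opnorm (qrf_povm F x D) = 1.

(* The measure D |-> Tr[w E^x(D)], which exists for every density operator w. *)
Definition is_povm_measure F x (w : qrf_field F x -> qrf_field F x)
    (m : {measure set (borel Gm) -> \bar R}) :=
  forall D : set Gm, measurable (D : set (borel Gm)) ->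
    m D = (complex.Re (trace (w \o qrf_povm F x (D `&` tfiber G x))))%:E.

Definition povm_measure F x (w : qrf_field F x -> qrf_field F x) :
    {measure set (borel Gm) -> \bar R} :=
  if pselect (exists m, is_povm_measure w m) is left ex then projT1 (cid ex)
  else mzero.

Definition povm_support F x : set Gm :=
  [set b | exists2 w : qrf_field F x -> qrf_field F x,
     density w & support_on (tfiber G x) (povm_measure w) b].

Definition centred_at F x (w_ : nat -> qrf_field F x -> qrf_field F x)
    (b : Gm) :=
  weak_cvg_on (tfiber G x) (fun n => povm_measure (w_ n))
    (\d_(b : borel Gm) : {measure set (borel Gm) -> \bar R}).

Definition localizing_sequence F x
    (w_ : nat -> qrf_field F x -> qrf_field F x) (b : Gm) :=
  (forall n, density (w_ n)) /\ centred_at w_ b.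

(* The ultraweak integral T over the target fibre of x, with respect to m, of
   b |-> V_b A_(src b) V_b^*.  An operator chi x on the fibre over x is tested
   as the value of a field chi, of which the integral only sees chi x: this
   avoids transporting operators along tgt b = x. *)
Definition is_relativization S (A : op_field (sys_field S)) x
    (m : {measure set (borel Gm) -> \bar R})
    (T : sys_field S x -> sys_field S x) :=
  bounded_op T /\
  forall chi : op_field (sys_field S), trace_class (chi x) ->
    let f b := trace (chi (tgt G b) \o
      (sys_rep S b \o A (src G b) \o adjoint (sys_rep S b))) in
    cintegrable m (tfiber G x) f /\
    trace (chi x \o T) = cintegral m (tfiber G x) f.

Definition relativization F S (w : op_field (qrf_field F))
    (A : op_field (sys_field S)) : op_field (sys_field S) :=
  fun x => xget (fun=> 0) (is_relativization A (povm_measure (w x))).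

End Frames.

Arguments relativization {R Gm M G F S} w A x _.

(* Main.v *)
(* Fix x in M and a trace-class operator chi on the fibre over x.  Writing
   chi = sum_k |a_k><b_k| with sum_k |a_k| |b_k| at most the trace norm of chi, one gets
     f(beta) := Tr[chi V_beta A_{s(beta)} V_beta^*]
              = sum_k <V_beta^* b_k, A_{s(beta)} V_beta^* a_k>
   on the target fibre of x.  Near a given arrow, V_beta^* a_k is norm-close to xi(s(beta))
   for a continuous section xi, by the continuity of V and because V_beta is isometric; hence
   each summand, and so f, is continuous and bounded on the fibre, and f(1_x) = Tr[chi A_x].
   By Riesz representation the relativization Rel(A)_x exists, and Tr[chi Rel(A)_x] is the
   integral of f against the POVM measure, which tends to f(1_x) along a localizing sequence.
   For the second statement this convergence is integrated over M by dominated convergence.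
   The measurability it requires is obtained by computing all traces in the Gram-Schmidt basis
   of a fundamental sequence of continuous sections, after modifying the fields on null sets,
   so that the POVM measures form a measurable kernel. *)
Require Import Defs.
From HB Require Import structures.
From mathcomp Require Import all_boot all_order all_algebra complex.
From mathcomp Require Import all_classical all_reals all_analysis.
From mathcomp Require Import measurable_realfun ring lra.

Set Implicit Arguments.
Unset Strict Implicit.
Unset Printing Implicit Defensive.

Import Order.TTheory GRing.Theory Num.Theory.
Import numFieldNormedType.Exports.

Local Open Scope classical_set_scope.
Local Open Scope ring_scope.

(** * Real-valued norms over the complex numbers *)

(** Adjoints, moduli, bases, POVM measures and relativizations are defined by choice with a default
    value, so each of them says nothing until an object with its defining property has been
    constructed. The expansion of [chi], called [nuclear] below, is the common tool: it yields trace
    bounds, cyclicity and independence of the basis, and it turns a trace depending on an arrow into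
    a dominated series of matrix coefficients. The obstacle to the continuity of f is that [V] and
    [A] are both known only through matrix coefficients, and a product of weakly continuous families
    need not be weakly continuous. For unitaries the weak continuity is strong continuity in
    disguise, so that a single weak limit, that of [A], remains. For measurability the obstacle is
    that [chosen_basis] varies with the base point without any regularity, while states and predual
    elements are measurable only up to null sets. *)

Definition nm (R : realType) (V : normedModType R[i]) (v : V) : R :=
  complex.Re `|v|.

Section RealNorm.
Context {R : realType}.
Implicit Types V : normedModType R[i].

Lemma norm_nm V (v : V) : `|v| = (nm v)%:C%C.
Proof. by rewrite /nm RRe_real // ger0_real. Qed.

Lemma nm_ge0 V (v : V) : 0 <= nm v.
Proof. by rewrite -ler0c -norm_nm. Qed.

Lemma nm0 V : nm (0 : V) = 0.
Proof. by rewrite /nm normr0. Qed.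

Lemma nm_eq0 V (v : V) : nm v = 0 -> v = 0.
Proof. by move=> v0; apply/eqP; rewrite -normr_eq0 norm_nm v0. Qed.

Lemma nmN V (v : V) : nm (- v) = nm v.
Proof. by rewrite /nm normrN. Qed.

Lemma nmBC V (u v : V) : nm (u - v) = nm (v - u).
Proof. by rewrite /nm distrC. Qed.

Lemma nmD V (u v : V) : nm (u + v) <= nm u + nm v.
Proof.
rewrite -lecR rmorphD /= -!norm_nm; exact: ler_normD.
Qed.

Lemma nmZ V (a : R[i]) (v : V) : nm (a *: v) = nm a * nm v.
Proof. by apply: complexI; rewrite rmorphM /= -!norm_nm normrZ. Qed.

Lemma nm_sum V n (F : 'I_n -> V) : nm (\sum_(k < n) F k) <= \sum_(k < n) nm (F k).
Proof.
elim/big_ind2 : _ => [|u a v b ua vb|//]; first by rewrite nm0.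
exact: le_trans (nmD _ _) (lerD ua vb).
Qed.

Lemma ltr0c (r : R) : (0 < r%:C%C) = (0 < r).
Proof. by rewrite ltcE /= eqxx. Qed.

Lemma nmM (a b : R[i]) : nm (a * b) = nm a * nm b.
Proof. by apply: complexI; rewrite rmorphM /= -!norm_nm normrM. Qed.

Lemma nmR (r : R) : nm (r%:C%C : R[i]) = `|r|.
Proof.
by rewrite /nm normc_def /= expr0n /= addr0 sqrtr_sqr.
Qed.

Lemma nmJ (a : R[i]) : nm (a^*)%C = nm a.
Proof. by rewrite /nm normcJ. Qed.

Lemma nm_sqr (a : R[i]) : nm a ^+ 2 = complex.Re a ^+ 2 + complex.Im a ^+ 2.
Proof.
by rewrite /nm normc_def /= sqr_sqrtr // addr_ge0 ?sqr_ge0.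
Qed.

Lemma mulJ_nm (a : R[i]) : a * (a^*)%C = (nm a ^+ 2)%:C%C.
Proof. by rewrite rmorphXn /= -norm_nm sqr_normc. Qed.

Lemma Re_le_nm (a : R[i]) : `|complex.Re a| <= nm a.
Proof. by rewrite -lecR -norm_nm normc_ge_Re. Qed.

Lemma Im_le_nm (a : R[i]) : `|complex.Im a| <= nm a.
Proof.
rewrite -(@ler_pXn2r _ 2) // ?nnegrE ?nm_ge0 //.
by rewrite real_normK ?num_real // nm_sqr lerDr sqr_ge0.
Qed.

Lemma nm_le_ReIm (a : R[i]) : nm a <= `|complex.Re a| + `|complex.Im a|.
Proof.
rewrite -(@ler_pXn2r _ 2) // ?nnegrE ?nm_ge0 ?addr_ge0 //.
rewrite nm_sqr sqrrD !real_normK ?num_real //.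
by rewrite lerD2r lerDl mulrn_wge0 // mulr_ge0.
Qed.

Lemma cvg_nmP V (T : Type) (F : set_system T) {FF : Filter F} (f : T -> V) (l : V) :
  f @ F --> l <-> (fun t => nm (f t - l)) @ F --> (0 : R).
Proof.
split=> [/cvgrPdist_lt fl|fl].
- apply/cvgrPdist_lt => e e0; rewrite /=.
  have := fl e%:C%C; rewrite ltr0c => /(_ e0); apply: filterS => t /=.
  by rewrite sub0r normrN ger0_norm ?nm_ge0 // nmBC norm_nm ltcR.
- apply/cvgrPdist_lt => e e0.
  have er : e = (complex.Re e)%:C%C by rewrite RRe_real // gtr0_real.
  rewrite er ltr0c in e0; move/cvgrPdist_lt : fl => /(_ _ e0); apply: filterS => t /=.
  by rewrite sub0r normrN ger0_norm ?nm_ge0 // nmBC norm_nm er ltcR.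
Qed.

Lemma cvg_nm_near V (T : Type) (F : set_system T) {FF : Filter F} (f : T -> V) (l : V) :
  f @ F --> l <-> forall e : R, 0 < e -> \forall t \near F, nm (f t - l) <= e.
Proof.
rewrite cvg_nmP; split=> [/cvgrPdist_le h e /h|h].
  by apply: filterS => t; rewrite sub0r normrN ger0_norm ?nm_ge0.
apply/cvgrPdist_le => e /h.
by apply: filterS => t; rewrite sub0r normrN ger0_norm ?nm_ge0.
Qed.

Lemma nm_cvg_unique V (T : Type) (F : set_system T) {FF : ProperFilter F} (f : T -> V) (l m : V) :
  f @ F --> l -> f @ F --> m -> l = m.
Proof. by move=> fl fm; apply: cvg_unique (@norm_hausdorff _ V) _ _ _ _ fl fm. Qed.

Lemma cvg_sumV V (T I : Type) (F : set_system T) {FF : Filter F} (r : seq I)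
    (f : I -> T -> V) (l : I -> V) :
  (forall i, f i @ F --> l i) ->
  (fun t => \sum_(i <- r) f i t) @ F --> \sum_(i <- r) l i.
Proof. by move=> fl; apply: cvg_big => // ; exact: add_continuous. Qed.

Lemma nm_cvg_le V (T : Type) (F : set_system T) {FF : ProperFilter F} (f : T -> V) l (B : R) :
  (\forall t \near F, nm (f t) <= B) -> f @ F --> l -> nm l <= B.
Proof.
move=> fB /cvg_nm_near fl; apply/ler_addgt0Pr => e e0.
have h := fl _ e0; near F => t.
rewrite -[l](subrK (f t)); apply: le_trans (nmD _ _) _.
by rewrite nmBC addrC lerD //; near: t.
Unshelve. all: by end_near. Qed.

(** Applied with [T v] for [v], it turns a bound on the form of [T] into a bound on [nm (T v)],
    without a case distinction on the vanishing of [T v]. *)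
Lemma nm_le_sqr V (v : V) (B : R) : 0 <= B -> nm v ^+ 2 <= B * nm v -> nm v <= B.
Proof.
move=> B0; have [->//|v0] := eqVneq (nm v) 0.
by rewrite expr2 ler_pM2r // lt_def v0 nm_ge0.
Qed.

End RealNorm.

(** * Positive semidefinite forms and Gram-Schmidt orthonormalization *)

(** Degenerate forms are included because Cauchy-Schwarz, Bessel and Gram-Schmidt serve twice: for
    [inner], and for [inner u (P v)] with a positive operator [P] that may have a kernel. *)
Record psd_form (R : realType) (V : lmodType R[i]) (s : V -> V -> R[i]) : Prop := {
  psdL : forall u a v w, s u (a *: v + w) = a * s u v + s u w ;
  psdC : forall u v, s v u = (s u v)^*%C ;
  psd_ge0 : forall u, 0 <= s u u }.

Section PsdForms.
Context {R : realType} {V : lmodType R[i]} {s : V -> V -> R[i]}.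
Hypothesis sP : psd_form s.
Implicit Types (u v w : V) (a : R[i]).

Let q v : R := complex.Re (s v v).

Lemma psd_diag v : s v v = (q v)%:C%C.
Proof. by rewrite /q RRe_real // ger0_real // (psd_ge0 sP). Qed.

Lemma psd_q_ge0 v : 0 <= q v.
Proof. by rewrite -ler0c -psd_diag (psd_ge0 sP). Qed.

Lemma psd0r u : s u 0 = 0.
Proof.
have := psdL sP u 1 0 0; rewrite scale1r addr0 mul1r => /eqP.
by rewrite -subr_eq0 opprD addNKr oppr_eq0 => /eqP.
Qed.

Lemma psdDr u v w : s u (v + w) = s u v + s u w.
Proof. by have := psdL sP u 1 v w; rewrite scale1r mul1r. Qed.

Lemma psdZr u a v : s u (a *: v) = a * s u v.
Proof. by have := psdL sP u a v 0; rewrite !addr0 psd0r addr0. Qed.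

Lemma psdNr u v : s u (- v) = - s u v.
Proof. by rewrite -scaleN1r psdZr mulN1r. Qed.

Lemma psdBr u v w : s u (v - w) = s u v - s u w.
Proof. by rewrite psdDr psdNr. Qed.

Lemma psd_sumr u (I : Type) (r : seq I) (P : pred I) (F : I -> V) :
  s u (\sum_(i <- r | P i) F i) = \sum_(i <- r | P i) s u (F i).
Proof.
elim/big_rec2 : _ => [|i v w _ <-]; [exact: psd0r | exact: psdDr].
Qed.

Lemma psd0l u : s 0 u = 0.
Proof. by rewrite (psdC sP) psd0r conjc0. Qed.

Lemma psdDl u v w : s (v + w) u = s v u + s w u.
Proof. by rewrite (psdC sP) psdDr rmorphD /= -!(psdC sP). Qed.

Lemma psdZl u a v : s (a *: v) u = (a^*)%C * s v u.
Proof. by rewrite (psdC sP) psdZr rmorphM /= -(psdC sP). Qed.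

Lemma psdNl u v : s (- v) u = - s v u.
Proof. by rewrite (psdC sP) psdNr rmorphN /= -(psdC sP). Qed.

Lemma psdBl u v w : s (v - w) u = s v u - s w u.
Proof. by rewrite psdDl psdNl. Qed.

Lemma psd_suml u (I : Type) (r : seq I) (P : pred I) (F : I -> V) :
  s (\sum_(i <- r | P i) F i) u = \sum_(i <- r | P i) s (F i) u.
Proof.
elim/big_rec2 : _ => [|i v w _ <-]; [exact: psd0l | exact: psdDl].
Qed.

Lemma psd_qB u v : q (u - v) = q u - complex.Re (s u v) *+ 2 + q v.
Proof.
rewrite /q psdBr !psdBl (psdC sP u v).
by case: (s u u) (s u v) (s v v) => [a b] [c d] [e f] /=; ring.
Qed.

Lemma cauchy_schwarz u v : nm (s u v) ^+ 2 <= q u * q v.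
Proof.
set N := nm (s u v) ^+ 2; have N0 : 0 <= N by rewrite sqr_ge0.
(* The coefficient proportional to the conjugate of [s u v] makes the cross term real. The best
   choice is [r = 1 / q v]; for a null [v] the bound is affine in [r], and a large [r] contradicts
   [N > 0]. *)
have key (r : R) : 0 <= q u - r * N *+ 2 + r ^+ 2 * N * q v.
  have := psd_q_ge0 (u - (r%:C%C * (s u v)^*%C) *: v).
  move=> /le_trans; apply; rewrite le_eqVlt; apply/orP; left; apply/eqP.
  rewrite psd_qB psdZr {2}/q psdZr psdZl psd_diag /N nm_sqr.
  by case: (s u v) => x y /=; ring.
have [qv0|qv0] := eqVneq (q v) 0.
- rewrite qv0 mulr0; rewrite leNgt; apply/negP => Npos.
  have := key ((q u + 1) / N); rewrite qv0 mulr0 addr0.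
  rewrite divfK ?gt_eqF //; have := psd_q_ge0 u; lra.
- have qv : 0 < q v by rewrite lt_def qv0 psd_q_ge0.
  have := key (q v)^-1.
  have -> : q u - (q v)^-1 * N *+ 2 + (q v)^-1 ^+ 2 * N * q v = q u - N / q v.
    by field.
  by rewrite subr_ge0 ler_pdivrMr.
Qed.

(** Zero entries are what Gram-Schmidt yields on a null residual; a zero entry also has zero
    coefficients, which is why Bessel's identity survives. *)
Definition psd_orthonormal (f : nat -> V) :=
  (forall i, s (f i) (f i) = 1 \/ f i = 0) /\ (forall i j, i != j -> s (f i) (f j) = 0).

Section Bessel.
Variable f : nat -> V.
Hypothesis fP : psd_orthonormal f.

Lemma psd_orth_coef i v : s (f i) (f i) * s (f i) v = s (f i) v.
Proof.
case: fP => f1 _; have [->|->] := f1 i; first by rewrite mul1r.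
by rewrite !psd0l mulr0.
Qed.

Lemma psd_sum_coef n (c : 'I_n -> R[i]) (k : 'I_n) :
  s (f k) (\sum_(i < n) c i *: f i) = c k * s (f k) (f k).
Proof.
rewrite psd_sumr (bigD1 k) //= psdZr big1 ?addr0 // => i ik.
by case: fP => _ f2; rewrite psdZr f2 ?mulr0 // eq_sym.
Qed.

Lemma psd_q_sum n (c : 'I_n -> R[i]) :
  q (\sum_(i < n) c i *: f i) <= \sum_(i < n) nm (c i) ^+ 2.
Proof.
rewrite /q psd_suml -lecR RRe_real; last first.
  by rewrite -psd_suml ger0_real ?(psd_ge0 sP).
rewrite rmorph_sum; apply: ler_sum => i _.
rewrite psdZl psd_sum_coef mulrA [_^*%C * _]mulrC mulJ_nm.
case: fP => f1 _; have [->|->] := f1 i; first by rewrite mulr1.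
by rewrite psd0l mulr0 ler0c sqr_ge0.
Qed.

Lemma bessel_eq n v :
  q (v - \sum_(i < n) s (f i) v *: f i) + \sum_(i < n) nm (s (f i) v) ^+ 2 = q v.
Proof.
rewrite psd_qB.
set u := \sum_(i < n) _ *: _; set t := \sum_(i < n) _ ^+ 2.
have vu : s v u = t%:C%C.
  rewrite psd_sumr rmorph_sum; apply: eq_bigr => i _ /=.
  by rewrite psdZr (psdC sP (f i)) mulJ_nm.
have uu : s u u = t%:C%C.
  rewrite psd_suml rmorph_sum; apply: eq_bigr => i _ /=.
  rewrite psdZl psd_sum_coef mulrA -[_ * _ * _]mulrA [_ * s (f i) (f i)]mulrC.
  by rewrite psd_orth_coef mulrC mulJ_nm.
by rewrite vu {2}/q uu /=; ring.
Qed.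

Lemma bessel n v : \sum_(i < n) nm (s (f i) v) ^+ 2 <= q v.
Proof. by rewrite -(bessel_eq n v) lerDr psd_q_ge0. Qed.

Lemma psd_residual_le n v : q (v - \sum_(i < n) s (f i) v *: f i) <= q v.
Proof. by rewrite -(bessel_eq n v) lerDl sumr_ge0 // => i _; rewrite sqr_ge0. Qed.

End Bessel.

Section GramSchmidt.
Variable g : nat -> V.

(* Vectors of zero seminorm are sent to 0, because 0^-1 = 0. *)
Definition psd_normalize v := ((Num.sqrt (q v))^-1)%:C%C *: v.

(** The recursion carries the whole projection off the first [n] vectors instead of the vectors
    alone, because it is later evaluated at arbitrary [v], in particular in [positive_residual]. *)
Fixpoint gs_residual n : V -> V :=
  if n is m.+1 then
    let f := psd_normalize (gs_residual m (g m)) in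
    fun v => gs_residual m v - s f v *: f
  else id.

Definition gs n := psd_normalize (gs_residual n (g n)).

Lemma gs_residualE n v : gs_residual n v = v - \sum_(i < n) s (gs i) v *: gs i.
Proof.
elim: n => [|n IH] /=; first by rewrite big_ord0 subr0.
by rewrite big_ord_recr /= opprD addrA -IH.
Qed.

Lemma psd_normalize_self v :
  s (psd_normalize v) (psd_normalize v) = 1 \/ psd_normalize v = 0.
Proof.
rewrite /psd_normalize; have [->|qv0] := eqVneq (q v) 0.
  by right; rewrite sqrtr0 invr0 scale0r.
left; rewrite psdZl psdZr psd_diag conjc_real -!rmorphM /=.
by rewrite mulrA -invfM -expr2 sqr_sqrtr ?psd_q_ge0 // mulVf.
Qed.

Lemma gs_orthonormal_lt n :
  (forall i v, (i < n)%N -> s (gs i) (gs_residual n v) = 0).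
Proof.
elim: n => [//|n IH] i v.
have o j : (j < n)%N -> s (gs j) (gs n) = 0.
  by move=> jn; rewrite {2}/gs /psd_normalize psdZr IH // mulr0.
have -> : gs_residual n.+1 v = gs_residual n v - s (gs n) v *: gs n by [].
rewrite ltnS leq_eqVlt psdBr psdZr => /orP[/eqP ->|ilt]; last first.
  by rewrite IH // o // mulr0 subrr.
rewrite gs_residualE psdBr psd_sumr big1 ?subr0; last first.
  by move=> j _; rewrite psdZr (psdC sP (gs j)) o // conjc0 mulr0.
have [->|->] : s (gs n) (gs n) = 1 \/ gs n = 0 := psd_normalize_self _.
  by rewrite mulr1 subrr.
by rewrite !psd0l mul0r subr0.
Qed.

Lemma gs_orthonormal : psd_orthonormal gs.
Proof.
split=> [i|i j]; first exact: psd_normalize_self.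
have lt (k l : nat) : (k < l)%N -> s (gs k) (gs l) = 0.
  by move=> kl; rewrite {2}/gs /psd_normalize psdZr gs_orthonormal_lt // mulr0.
rewrite neq_ltn => /orP[/lt //|ji]; by rewrite (psdC sP) lt ?conjc0.
Qed.

Lemma gs_coef n v : s (gs n) (gs_residual n v) = s (gs n) v.
Proof.
rewrite gs_residualE psdBr psd_sumr big1 ?subr0 // => i _.
by case: gs_orthonormal => _ o; rewrite psdZr o ?mulr0 // neq_ltn ltn_ord orbT.
Qed.

Lemma gs_residualS n v : gs_residual n.+1 v = gs_residual n v - s (gs n) v *: gs n.
Proof. by []. Qed.

Lemma gs_residual_null n j : (j < n)%N -> q (gs_residual n (g j)) = 0.
Proof.
move=> jn; apply/eqP; rewrite eq_le psd_q_ge0 andbT.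
(* Stage [j.+1] removes the direction of the residual of [g j] itself: what remains is 0, or a null
   vector left untouched. Later stages can only decrease [q]. *)
have -> : 0 = q (gs_residual j.+1 (g j)).
  rewrite gs_residualS -gs_coef /gs; set v := gs_residual j (g j).
  rewrite /psd_normalize; have [qv|qv] := eqVneq (q v) 0.
    by rewrite qv sqrtr0 invr0 !scale0r psd0l scale0r subr0 qv.
  rewrite psdZl scalerA psd_diag conjc_real -!rmorphM /= mulrAC -invfM -expr2.
  by rewrite sqr_sqrtr ?psd_q_ge0 // mulVf // scale1r subrr /q psd0l.
elim: n jn => [//|n IH]; rewrite ltnS leq_eqVlt => /orP[/eqP -> //|jn].
apply: le_trans (IH jn); rewrite gs_residualS -gs_coef.
set v := gs_residual n (g j).
(* Padding [gs n] with zeros lets [psd_residual_le] remove exactly one direction. *)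
have o' : psd_orthonormal (fun i => if i == 0%N then gs n else 0).
  split=> [[|i]|[|i] [|j']] //=; try by right.
  - by case: gs_orthonormal => + _; exact.
  - by rewrite psd0r.
  - by rewrite psd0l.
  - by rewrite psd0l.
have := psd_residual_le o' 1 v; by rewrite big_ord1.
Qed.

End GramSchmidt.
End PsdForms.

Arguments psd_orthonormal {R V} s f.
Arguments psd_normalize {R V} s v.
Arguments gs_residual {R V} s g n _.
Arguments gs {R V} s g n.

Lemma squeeze0 (R : realType) (T : Type) (F : set_system T) {FF : Filter F}
    (f g : T -> R) :
  (forall t, 0 <= f t) -> (\forall t \near F, f t <= g t) -> g @ F --> (0 : R) ->
  f @ F --> (0 : R).
Proof.
move=> f0 fg g0; apply: (squeeze_cvgr _ (cvg_cst 0) g0).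
by apply: filterS fg => t ->; rewrite f0.
Qed.

(** * Hilbert bases and the Riesz representation theorem *)

Section LinearMaps.
Context {R : realType} {V W : lmodType R[i]} {T : V -> W}.
Hypothesis TL : linear T.

Lemma lin0 : T 0 = 0.
Proof. by have := TL (-1) 0 0; rewrite scaler0 addr0 scaleN1r addNr. Qed.

Lemma linD u v : T (u + v) = T u + T v.
Proof. by have := TL 1 u v; rewrite !scale1r. Qed.

Lemma linZ a u : T (a *: u) = a *: T u.
Proof. by have := TL a u 0; rewrite lin0 !addr0. Qed.

Lemma linN u : T (- u) = - T u.
Proof. by rewrite -scaleN1r linZ scaleN1r. Qed.

Lemma linB u v : T (u - v) = T u - T v.
Proof. by rewrite linD linN. Qed.

Lemma lin_sum (I : Type) (r : seq I) (P : pred I) (F : I -> V) :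
  T (\sum_(i <- r | P i) F i) = \sum_(i <- r | P i) T (F i).
Proof. elim/big_rec2 : _ => [|i v w _ <-]; [exact: lin0 | exact: linD]. Qed.

End LinearMaps.

Section InnerProduct.
Context {R : realType} {H : hilbertType R}.
Implicit Types (u v w : H) (a : R[i]).

Lemma inner_psd : psd_form (@inner R H).
Proof.
split=> [u a v w|u v|u]; first exact: inner_scalar.
- exact: inner_conj.
- by rewrite inner_norm exprn_ge0.
Qed.

Lemma innerC u v : inner v u = (inner u v)^*%C. Proof. exact: inner_conj. Qed.
Definition inner0r := psd0r inner_psd.
Definition inner0l := psd0l inner_psd.
Definition innerDr := psdDr inner_psd.
Definition innerDl := psdDl inner_psd.
Definition innerZr := psdZr inner_psd.
Definition innerZl := psdZl inner_psd.
Definition innerBr := psdBr inner_psd.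
Definition innerBl := psdBl inner_psd.
Definition inner_sumr := psd_sumr inner_psd.
Definition inner_suml := psd_suml inner_psd.

Lemma inner_diag v : inner v v = (nm v ^+ 2)%:C%C.
Proof. by rewrite inner_norm norm_nm rmorphXn. Qed.

Lemma Re_inner_diag v : complex.Re (inner v v) = nm v ^+ 2.
Proof. by rewrite inner_diag. Qed.

Lemma inner_le u v : nm (inner u v) <= nm u * nm v.
Proof.
rewrite -(@ler_pXn2r _ 2) // ?nnegrE ?mulr_ge0 ?nm_ge0 //.
by rewrite exprMn -!Re_inner_diag (cauchy_schwarz inner_psd).
Qed.

Lemma inner_eq0 v : inner v v = 0 -> v = 0.
Proof.
by rewrite inner_diag => /complexI/eqP; rewrite sqrf_eq0 => /eqP/nm_eq0.
Qed.

Lemma inner_inj u v : (forall w, inner w u = inner w v) -> u = v.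
Proof.
by move=> h; apply/eqP; rewrite -subr_eq0; apply/eqP/inner_eq0; rewrite innerBr h subrr.
Qed.

Lemma nm_sqrB u v : nm (u - v) ^+ 2 = nm u ^+ 2 - complex.Re (inner u v) *+ 2 + nm v ^+ 2.
Proof. by rewrite -!Re_inner_diag (psd_qB inner_psd). Qed.

Lemma cvg_inner (T : Type) (F : set_system T) {FF : Filter F} v (f : T -> H) l :
  f @ F --> l -> (fun t => inner v (f t)) @ F --> inner v l.
Proof.
move=> /cvg_nmP fl; apply/cvg_nmP.
apply: (@squeeze0 _ _ _ _ _ (fun t => nm v * nm (f t - l))).
- by move=> t; exact: nm_ge0.
- by apply: nearW => t; rewrite -innerBr inner_le.
- by rewrite -[X in _ --> X](mulr0 (nm v)); apply: cvgMr.
Qed.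

End InnerProduct.

Arguments cvg_inner {R H T F FF} v {f l} _.

Section Bases.
Context {R : realType} {H : hilbertType R}.
Implicit Types (u v w : H) (e : nat -> H) (c : nat -> R[i]).

Lemma riesz_fischer e c (B : R) : psd_orthonormal inner e ->
  (forall n, \sum_(i < n) nm (c i) ^+ 2 <= B) ->
  exists v, series (fun i => c i *: e i) @ \oo --> v.
Proof.
move=> eP cB.
have : cvgn (series (fun i => nm (c i) ^+ 2)).
  apply: nondecreasing_is_cvgn.
    by apply: nondecreasing_series => i _ _; rewrite sqr_ge0.
  by exists B => _ [n _ <-]; rewrite /series /= big_mkord.
move=> /cvg_cauchy/cauchy_seriesP cC.
suff : cvgn (series (fun i => c i *: e i)).
  by move=> ?; exists (limn (series (fun i => c i *: e i))).
apply: cauchy_cvg; apply/cauchy_seriesP => eps eps0.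
have er : eps = (complex.Re eps)%:C%C by rewrite RRe_real // gtr0_real.
rewrite er ltr0c in eps0 *.
have := cC (complex.Re eps ^+ 2); rewrite exprn_gt0 // => /(_ isT).
apply: filterS => -[m n] /= h; rewrite norm_nm ltcR.
rewrite ger0_norm ?sumr_ge0 // in h; last by move=> i _; rewrite sqr_ge0.
rewrite (big_nat_widenl m 0%N) // big_mkcond big_mkord /= in h.
rewrite (big_nat_widenl m 0%N) // big_mkcond big_mkord /=.
rewrite -(@ltr_pXn2r _ 2) // ?nnegrE ?nm_ge0 ?(ltW eps0) //.
apply: le_lt_trans h; rewrite -Re_inner_diag.
(* The block from [m] to [n] is read as a full sum whose coefficients vanish below [m], the shape
   that [psd_q_sum] bounds. *)
rewrite (eq_bigr (fun i : 'I_n => (if (m <= i)%N then c i else 0) *: e i)); last first.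
  by move=> i _; case: ifP => //; rewrite scale0r.
apply: le_trans (psd_q_sum inner_psd eP _) _; apply: ler_sum => i _.
by case: ifP => // _; rewrite nm0 expr0n.
Qed.

Lemma orthonormal_basis_psd e : orthonormal_basis e -> psd_orthonormal inner e.
Proof.
case=> e1 e2 _; split=> // i; have [->|ei] := e1 i; [by right|left].
by rewrite inner_norm ei expr1n.
Qed.

Lemma parseval e v : orthonormal_basis e ->
  series (fun i => inner (e i) v *: e i) @ \oo --> v.
Proof.
move=> eB; have eP := orthonormal_basis_psd eB.
have [u hu] := @riesz_fischer e (fun i => inner (e i) v) _ eP (fun n => bessel inner_psd eP n v).
suff vu : v = u by rewrite -vu in hu.
apply/eqP; rewrite -subr_eq0; apply/eqP; case: (eB) => _ e2; apply=> i.
apply/eqP; rewrite innerBr subr_eq0; apply/eqP.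
have h1 : inner (e i) \o series (fun i => inner (e i) v *: e i) @ \oo --> inner (e i) u.
  exact: cvg_inner hu.
suff h2 : inner (e i) \o series (fun i => inner (e i) v *: e i) @ \oo --> inner (e i) v.
  exact: nm_cvg_unique h2 h1.
apply: cvg_near_cst; exists i.+1 => // n /= ilt.
rewrite /series /= big_mkord.
have := psd_sum_coef inner_psd eP (fun k : 'I_n => inner (e k) v) (Ordinal ilt).
by move=> /= ->; rewrite mulrC (psd_orth_coef inner_psd eP).
Qed.


(** Separability is expressed by a total sequence, which is what a fundamental sequence of sections
    gives on each fibre and what Gram-Schmidt consumes. *)
Definition separable_hilbert := exists g : nat -> H, forall v (eps : R), 0 < eps ->
  exists (n : nat) (c : 'I_n -> R[i]), nm (v - \sum_(k < n) c k *: g k) <= eps.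

Lemma orthonormal_basis_total (g e : nat -> H) : 
  psd_orthonormal inner e ->
  (forall v (eps : R), 0 < eps ->
    exists (n : nat) (c : 'I_n -> R[i]), nm (v - \sum_(k < n) c k *: g k) <= eps) ->
  (forall v, (forall i, inner (e i) v = 0) -> forall k, inner (g k) v = 0) ->
  orthonormal_basis e.
Proof.
move=> [e1 e2] gd eg; split=> //.
  move=> i; have [h|->] := e1 i; [right|by left].
  apply/eqP; rewrite -(@eqrXn2 _ 2) // -inner_norm h expr1n //.
move=> v /eg gv; apply: nm_eq0; apply/eqP; rewrite eq_le nm_ge0 andbT.
rewrite leNgt; apply/negP => v0.
(* An error of half the norm suffices: [v] is orthogonal to the combination, so its squared norm
   would be at most half of itself. *)
have [n [c h]] := gd v (nm v / 2) (divr_gt0 v0 (ltr0n _ 2)).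
have : nm v ^+ 2 <= nm v / 2 * nm v.
  rewrite -Re_inner_diag; apply: le_trans (ler_wpM2r (nm_ge0 v) h).
  apply: le_trans (inner_le _ _).
  rewrite innerBl inner_suml big1 ?subr0; last by move=> i _; rewrite innerZl gv mulr0.
  exact: le_trans (ler_norm _) (Re_le_nm _).
rewrite expr2 ler_pM2r //; lra.
Qed.

Lemma gs_basis (g : nat -> H) :
  (forall v (eps : R), 0 < eps ->
    exists (n : nat) (c : 'I_n -> R[i]), nm (v - \sum_(k < n) c k *: g k) <= eps) ->
  orthonormal_basis (gs inner g).
Proof.
move=> gd; apply: orthonormal_basis_total gd _; first exact: gs_orthonormal inner_psd _.
move=> v ev k; have := gs_residual_null inner_psd g (ltnSn k).
rewrite Re_inner_diag => /eqP; rewrite sqrf_eq0 => /eqP/nm_eq0.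
rewrite gs_residualE => /eqP; rewrite subr_eq0 => /eqP ->.
by rewrite inner_suml big1 // => i _; rewrite innerZl ev mulr0.
Qed.

Lemma chosen_basisP : separable_hilbert -> orthonormal_basis (@chosen_basis R H).
Proof.
by move=> [g /gs_basis gB]; rewrite /chosen_basis; apply: (@xgetI _ _ _ (gs inner g)).
Qed.

(** The functional is conjugate-linear because [v] occupies the first slot of [inner]. *)
Lemma riesz e (phi : H -> R[i]) (C : R) : orthonormal_basis e ->
  (forall a v w, phi (a *: v + w) = (a^*)%C * phi v + phi w) ->
  (forall v, nm (phi v) <= C * nm v) ->
  exists u, forall v, inner v u = phi v.
Proof.
move=> eB phiL phiC; have eP := orthonormal_basis_psd eB.
have phi0 : phi 0 = 0 by have := phiL (-1) 0 0; rewrite scaler0 addr0 rmorphN rmorph1 mulN1r addNr.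
have phiZ a v : phi (a *: v) = (a^*)%C * phi v by have := phiL a v 0; rewrite phi0 !addr0.
have phiD v w : phi (v + w) = phi v + phi w.
  by have := phiL 1 v w; rewrite scale1r rmorph1 mul1r.
have phi_sum n (F : 'I_n -> H) : phi (\sum_(i < n) F i) = \sum_(i < n) phi (F i).
  by elim/big_rec2 : _ => [|i v w _ <-].
have bnd n : \sum_(i < n) nm (phi (e i)) ^+ 2 <= C ^+ 2.
  (* Testing [phi] on [p] gives [S = phi p <= C * nm p], while [nm p ^+ 2 <= S]; hence
     [S <= C ^+ 2]. *)
  set S := \sum_(i < n) _; pose p := \sum_(i < n) phi (e i) *: e i.
  have S0 : 0 <= S by apply: sumr_ge0 => i _; rewrite sqr_ge0.
  have pS : nm p ^+ 2 <= S.
    by rewrite -Re_inner_diag; exact: (psd_q_sum inner_psd eP (fun i : 'I_n => phi (e i))).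
  have phip : phi p = S%:C%C.
    rewrite /p phi_sum rmorph_sum; apply: eq_bigr => i _ /=.
    by rewrite phiZ mulrC mulJ_nm.
  have := phiC p; rewrite phip nmR ger0_norm // => SC.
  have [->|Sn0] := eqVneq S 0; first exact: sqr_ge0.
  have Sp : 0 < S by rewrite lt_def Sn0.
  rewrite -(ler_pM2r Sp) -expr2; apply: le_trans (ler_wpM2l (sqr_ge0 C) pS).
  by rewrite -exprMn ler_pXn2r // nnegrE ?(le_trans S0 SC).
have [u hu] := @riesz_fischer e (phi \o e) _ eP bnd.
exists u => v.
have h1 : inner v \o series (fun i => phi (e i) *: e i) @ \oo --> inner v u by exact: cvg_inner hu.
suff h2 : inner v \o series (fun i => phi (e i) *: e i) @ \oo --> phi v.
  exact: nm_cvg_unique h1 h2.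
have := parseval (v := v) eB => /cvg_nmP hv; apply/cvg_nmP.
apply: (@squeeze0 _ _ _ _ _ (fun n => `|C| * nm (series (fun i => inner (e i) v *: e i) n - v))).
- by move=> ?; exact: nm_ge0.
- apply: nearW => n /=.
  have -> : inner v (series (fun i => phi (e i) *: e i) n) =
            phi (series (fun i => inner (e i) v *: e i) n).
    rewrite /series /= !big_mkord inner_sumr phi_sum; apply: eq_bigr => i _.
    by rewrite innerZr phiZ -innerC mulrC.
  rewrite -[- phi v]mulN1r -(rmorph1 (@conjc R)) -rmorphN -phiZ -phiD scaleN1r.
  apply: le_trans (phiC _) _; apply: ler_wpM2r; [exact: nm_ge0 | exact: ler_norm].
- by rewrite -[X in _ --> X](mulr0 `|C|); apply: cvgMr.
Qed.

End Bases.

Arguments parseval {R H e} v _.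

(** * Complex series and Tannery's theorem *)

Section ReIm.
Context {R : realType}.
Implicit Types a b : R[i].

Lemma cReD a b : complex.Re (a + b) = complex.Re a + complex.Re b.
Proof. by case: a b => [? ?] []. Qed.

Lemma cImD a b : complex.Im (a + b) = complex.Im a + complex.Im b.
Proof. by case: a b => [? ?] []. Qed.

Lemma cReB a b : complex.Re (a - b) = complex.Re a - complex.Re b.
Proof. by case: a b => [? ?] []. Qed.

Lemma cImB a b : complex.Im (a - b) = complex.Im a - complex.Im b.
Proof. by case: a b => [? ?] []. Qed.

Lemma cReM a b : complex.Re (a * b) =
  complex.Re a * complex.Re b - complex.Im a * complex.Im b.
Proof. by case: a b => [? ?] []. Qed.

Lemma cImM a b : complex.Im (a * b) =
  complex.Re a * complex.Im b + complex.Im a * complex.Re b.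
Proof. by case: a b => [? ?] []. Qed.

Lemma cRe_sum (I : Type) (r : seq I) (P : pred I) (F : I -> R[i]) :
  complex.Re (\sum_(i <- r | P i) F i) = \sum_(i <- r | P i) complex.Re (F i).
Proof. by elim/big_rec2 : _ => // i v w _ <-; rewrite cReD. Qed.

Lemma cIm_sum (I : Type) (r : seq I) (P : pred I) (F : I -> R[i]) :
  complex.Im (\sum_(i <- r | P i) F i) = \sum_(i <- r | P i) complex.Im (F i).
Proof. by elim/big_rec2 : _ => // i v w _ <-; rewrite cImD. Qed.

End ReIm.

Section Series.
Context {R : realType}.
Implicit Types (u : nat -> R[i]) (beta : nat -> R).

Lemma cvg_Re (T : Type) (F : set_system T) {FF : Filter F} (f : T -> R[i]) l :
  f @ F --> l -> (fun t => complex.Re (f t)) @ F --> complex.Re l.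
Proof.
move=> /cvg_nm_near fl; apply/cvgrPdist_le => e /fl; apply: filterS => t.
by apply: le_trans; rewrite nmBC /= -cReB; exact: Re_le_nm.
Qed.

Lemma cvg_Im (T : Type) (F : set_system T) {FF : Filter F} (f : T -> R[i]) l :
  f @ F --> l -> (fun t => complex.Im (f t)) @ F --> complex.Im l.
Proof.
move=> /cvg_nm_near fl; apply/cvgrPdist_le => e /fl; apply: filterS => t.
by apply: le_trans; rewrite nmBC /= -cImB; exact: Im_le_nm.
Qed.

Lemma cvg_ReIm (T : Type) (F : set_system T) {FF : Filter F} (f : T -> R[i]) l :
  (fun t => complex.Re (f t)) @ F --> complex.Re l ->
  (fun t => complex.Im (f t)) @ F --> complex.Im l ->
  f @ F --> l.
Proof.
move=> /cvgrPdist_le fr /cvgrPdist_le fi; apply/cvg_nm_near => e e0.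
have e20 : 0 < e / 2 by rewrite divr_gt0.
apply: filterS2 (fr _ e20) (fi _ e20) => t /= hr hi.
rewrite nmBC; apply: le_trans (nm_le_ReIm _) _; rewrite cReB cImB; lra.
Qed.


Lemma bounded_series_cvg beta (B : R) : (forall k, 0 <= beta k) ->
  (forall n, \sum_(k < n) beta k <= B) -> cvgn (series beta).
Proof.
move=> b0 bB; apply: nondecreasing_is_cvgn.
  by apply: nondecreasing_series => i _ _.
by exists B => _ [n _ <-]; rewrite /series /= big_mkord.
Qed.

Lemma dominated_series_cvg u beta (B : R) : (forall k, nm (u k) <= beta k) ->
  (forall n, \sum_(k < n) beta k <= B) -> exists l : R[i], series u @ \oo --> l.
Proof.
move=> ub bB; have b0 k : 0 <= beta k by exact: le_trans (nm_ge0 _) (ub k).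
have bC := bounded_series_cvg b0 bB.
have Cr : cvgn (series (fun k => complex.Re (u k))).
  apply: normed_cvg; apply: (series_le_cvg _ _ _ bC) => k /=; rewrite ?normr_ge0 ?b0 //.
  exact: le_trans (Re_le_nm _) (ub k).
have Ci : cvgn (series (fun k => complex.Im (u k))).
  apply: normed_cvg; apply: (series_le_cvg _ _ _ bC) => k /=; rewrite ?normr_ge0 ?b0 //.
  exact: le_trans (Im_le_nm _) (ub k).
exists (limn (series (fun k => complex.Re (u k))) +i* limn (series (fun k => complex.Im (u k))))%C.
apply: cvg_ReIm => /=.
- have -> : (fun n => complex.Re (series u n)) = series (fun k => complex.Re (u k)); last by [].
  by apply/funext => n; rewrite /series cRe_sum.
- have -> : (fun n => complex.Im (series u n)) = series (fun k => complex.Im (u k)); last by [].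
  by apply/funext => n; rewrite /series cIm_sum.
Qed.

Lemma series_tail_le u beta (b : R) (l : R[i]) n : (forall k, nm (u k) <= beta k) ->
  series u @ \oo --> l -> series beta @ \oo --> b -> nm (l - series u n) <= b - series beta n.
Proof.
move=> ub ul bl; apply/ler_addgt0Pr => e e0.
have e20 : 0 < e / 2 by rewrite divr_gt0.
move/cvg_nm_near : ul => /(_ _ e20) h1; move/cvgrPdist_le : bl => /(_ _ e20) h2.
have [m [h1m h2m nlem]] : exists m,
    [/\ nm (series u m - l) <= e / 2, `|b - series beta m| <= e / 2 & (n <= m)%N].
  have h3 : \forall m \near \oo, (n <= m)%N by exact: nbhs_infty_ge.
  near \oo => m; exists m; split; near: m; [exact: h1|exact: h2|exact: h3].
have -> : l - series u n = - (series u m - l) + (series u m - series u n).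
  by rewrite opprB addrA subrK.
apply: le_trans (nmD _ _) _; rewrite nmN.
have : nm (series u m - series u n) <= series beta m - series beta n.
  rewrite !sub_series_geq //.
  elim/big_ind2 : _ => [|v a w c va wc|//]; first by rewrite nm0.
  exact: le_trans (nmD _ _) (lerD va wc).
move: h2m; rewrite ler_norml => /andP[? ?]; lra.
Unshelve. all: by end_near. Qed.

(** The tails of [beta] bound those of [u t] uniformly in [t], so only finitely many terms have to
    converge. The limit is returned as an unnamed sum [l], which callers identify by uniqueness of
    limits. *)
Lemma tannery (T : Type) (F : set_system T) {FF : ProperFilter F} (u : T -> nat -> R[i])
    (c : nat -> R[i]) (S : T -> R[i]) beta (B : R) :
  (forall n, \sum_(k < n) beta k <= B) ->
  (\forall t \near F, forall k, nm (u t k) <= beta k) ->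
  (\forall t \near F, series (u t) @ \oo --> S t) ->
  (forall k, u ^~ k @ F --> c k) ->
  exists l : R[i], series c @ \oo --> l /\ S @ F --> l.
Proof.
move=> bB ub uS uc.
have cb k : nm (c k) <= beta k.
  by apply: nm_cvg_le (uc k); apply: filterS ub.
have b0 k : 0 <= beta k by exact: le_trans (nm_ge0 _) (cb k).
have [l cl] := dominated_series_cvg cb bB; exists l; split=> //.
have bcvg := bounded_series_cvg b0 bB; set b := limn (series beta) in bcvg.
apply/cvg_nm_near => e e0.
have e30 : 0 < e / 3 by rewrite divr_gt0.
have [N hN] : exists N, b - series beta N <= e / 3.
  have /cvgrPdist_le/(_ _ e30) h := bcvg.
  near \oo => N; exists N; apply: le_trans (ler_norm _) _; near: N; exact: h.
have hcN : (fun t => series (u t) N) @ F --> series c N.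
  by rewrite /series /=; apply: cvg_sumV.
move/cvg_nm_near : hcN => /(_ _ e30) hcN.
have hl := le_trans (series_tail_le N cb cl bcvg) hN.
apply: filterS3 ub uS hcN => t tb tS tN.
have hS := le_trans (series_tail_le N tb tS bcvg) hN.
have -> : S t - l = (S t - series (u t) N) + ((series (u t) N - series c N) - (l - series c N)).
  by rewrite opprB [series (u t) N - _ + _]addrA !subrK addrA subrK.
apply: le_trans (nmD _ _) _.
have := nmD (series (u t) N - series c N) (- (l - series c N)); rewrite nmN; lra.
Unshelve. all: by end_near. Qed.

End Series.

(** * Bounded operators, nuclear expansions and traces *)

Section BoundedOperators.
Context {R : realType}.
Implicit Types H K L : hilbertType R.

Lemma op_bounded_nm H K (C : R) (T : H -> K) :
  op_bounded_by C T <-> forall v, nm (T v) <= C * nm v.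
Proof. by split=> h v; move: (h v); rewrite !norm_nm -rmorphM lecR. Qed.

Lemma bounded_opP H K (T : H -> K) :
  bounded_op T <-> linear T /\ exists2 C : R, 0 <= C & forall v, nm (T v) <= C * nm v.
Proof.
split=> -[TL [C]].
  move=> /op_bounded_nm h; split=> //; exists `|C| => // v.
  by apply: le_trans (h v) _; rewrite ler_wpM2r ?nm_ge0 // ler_norm.
by move=> C0 /op_bounded_nm h; split=> //; exists C.
Qed.

Lemma bounded_comp H K L (S : K -> L) (T : H -> K) :
  bounded_op S -> bounded_op T -> bounded_op (S \o T).
Proof.
move=> /bounded_opP[SL [C C0 SC]] /bounded_opP[TL [D D0 TD]].
apply/bounded_opP; split; first by move=> a u v /=; rewrite TL SL.
exists (C * D) => [|v /=]; first exact: mulr_ge0.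
by apply: le_trans (SC _) _; rewrite -mulrA ler_wpM2l.
Qed.

Lemma bounded_id H : bounded_op (@id H).
Proof. by apply/bounded_opP; split=> //; exists 1 => // v; rewrite mul1r. Qed.

Lemma bounded_cvg H K (T : H -> K) (X : Type) (F : set_system X) {FF : Filter F}
    (f : X -> H) l : bounded_op T -> f @ F --> l -> T \o f @ F --> T l.
Proof.
move=> /bounded_opP[TL [C C0 TC]] /cvg_nmP fl; apply/cvg_nmP.
apply: (@squeeze0 _ _ _ _ _ (fun t => C * nm (f t - l))).
- by move=> t; exact: nm_ge0.
- by apply: nearW => t; rewrite /= -(linB TL) TC.
- by rewrite -[X in _ --> X](mulr0 C); apply: cvgMr.
Qed.

(** Riesz representation of [v |-> inner (T v) w] supplies a witness for the choice that defines
    [adjoint]. *)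
Lemma adjointP H K (e : nat -> H) (T : H -> K) : orthonormal_basis e -> bounded_op T ->
  forall w v, inner (adjoint T w) v = inner w (T v).
Proof.
move=> eB /bounded_opP[TL [C C0 TC]].
suff [S hS] : exists S, forall w v, inner (S w) v = inner w (T v).
  exact: (@xgetI _ (fun=> 0) [set S | forall w v, inner (S w) v = inner w (T v)] S).
suff /choice[S hS] : forall w, exists u, forall v, inner u v = inner w (T v).
  by exists S.
move=> w; have [|v|u hu] := @riesz _ _ e (fun v => inner (T v) w) (C * nm w) eB.
- by move=> a u v; rewrite TL innerDl innerZl.
- apply: le_trans (inner_le _ _) _; rewrite mulrAC.
  by rewrite ler_wpM2r ?nm_ge0.
- by exists u => v; rewrite innerC hu -innerC.
Qed.

Lemma adjoint_unique H K (T : H -> K) (S S' : K -> H) :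
  (forall w v, inner (S w) v = inner w (T v)) ->
  (forall w v, inner (S' w) v = inner w (T v)) -> S = S'.
Proof.
move=> hS hS'; apply/funext => w; apply: inner_inj => v.
by rewrite innerC hS -hS' -innerC.
Qed.

Lemma adjoint_eq H K (T : H -> K) (S : K -> H) :
  (forall w v, inner (S w) v = inner w (T v)) -> adjoint T = S.
Proof.
move=> hS; apply: (adjoint_unique _ hS).
exact: (@xgetI _ (fun=> 0) [set S | forall w v, inner (S w) v = inner w (T v)] S).
Qed.

Lemma adjoint_bound H K (e : nat -> H) (T : H -> K) (C : R) : orthonormal_basis e ->
  bounded_op T -> 0 <= C -> (forall v, nm (T v) <= C * nm v) ->
  forall w, nm (adjoint T w) <= C * nm w.
Proof.
move=> eB Tb C0 TC w; apply: nm_le_sqr; first by rewrite mulr_ge0 ?nm_ge0.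
rewrite -Re_inner_diag (adjointP eB Tb).
apply: le_trans (le_trans (ler_norm _) (Re_le_nm _)) _.
apply: le_trans (inner_le _ _) _.
by rewrite mulrC mulrAC ler_wpM2r ?nm_ge0.
Qed.

Lemma positive_psd H (P : H -> H) :
  linear P -> positive_op P -> psd_form (fun u v => inner u (P v)).
Proof.
move=> PL P0; split=> // [u a v w|u v]; first by rewrite PL innerDr innerZr.
have im0 w : complex.Im (inner w (P w)) = 0 by exact/ger0_Im/P0.
(* Polarization: realness of the form at [u + v] compares the imaginary parts of the two
   off-diagonal terms, and realness at [u + 'i v] their real parts. *)
have := im0 (u + v); have := im0 (u + 'i%C *: v).
rewrite !(linD PL) (linZ PL) !innerDl !innerDr !innerZl !innerZr.
have := im0 u; have := im0 v.
case: (inner u (P u)) (inner u (P v)) (inner v (P u)) (inner v (P v)) => [a b] [c d] [x y] [z t] /=.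
move=> -> ->; rewrite ?mul0r ?mul1r ?oppr0 ?add0r ?addr0 ?subr0 => h1 h2.
by apply/eqP; rewrite eq_complex /=; apply/andP; split; apply/eqP; lra.
Qed.

Lemma positive_selfadjoint H (P : H -> H) : linear P -> positive_op P ->
  forall u v, inner (P u) v = inner u (P v).
Proof. by move=> PL P0 u v; rewrite innerC (psdC (positive_psd PL P0) u v) conjcK. Qed.

Lemma nm_modulus H K (e : nat -> H) (T : H -> K) (P : H -> H) v :
  orthonormal_basis e -> bounded_op T -> is_modulus T P -> nm (P v) = nm (T v).
Proof.
move=> eB Tb [Pb P0 PT]; have [PL _] := Pb.
apply/eqP; rewrite -(@eqrXn2 _ 2) ?nm_ge0 // -!Re_inner_diag.
by rewrite (positive_selfadjoint PL P0) PT innerC (adjointP eB Tb) -innerC.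
Qed.

Lemma nm_projection H (e : nat -> H) n v : psd_orthonormal inner e ->
  nm (\sum_(i < n) inner (e i) v *: e i) <= nm v.
Proof.
move=> eP; rewrite -(@ler_pXn2r _ 2) // ?nnegrE ?nm_ge0 // -!Re_inner_diag.
apply: le_trans (psd_q_sum inner_psd eP _) _; exact: (bessel inner_psd eP).
Qed.

Lemma parseval_nm H (e : nat -> H) v : orthonormal_basis e ->
  series (fun i => nm (inner (e i) v) ^+ 2) @ \oo --> nm v ^+ 2.
Proof.
move=> eB; have eP := orthonormal_basis_psd eB.
have /cvg_nmP h := parseval v eB.
rewrite -[X in _ --> X]subr0 -[X in _ - X](expr0n _ 2).
have -> : series (fun i => nm (inner (e i) v) ^+ 2) =
    fun n => nm v ^+ 2 - (nm (series (fun i => inner (e i) v *: e i) n - v)) ^+ 2.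
  apply/funext => n; rewrite nmBC -!Re_inner_diag /series /= !big_mkord.
  by have := bessel_eq inner_psd eP n v => <-; rewrite [X in X - _]addrC addrK.
apply: cvgB; first exact: cvg_cst.
exact: (cvgM h h).
Qed.

(* [T] is the sum of the operators [ketbra (a k) (b k)], absolutely convergent for
   the trace norm. *)
Definition nuclear H K (a : nat -> K) (b : nat -> H) (B : R) (T : H -> K) :=
  (forall n, \sum_(k < n) nm (a k) * nm (b k) <= B) /\
  forall v, series (fun k => inner (b k) v *: a k) @ \oo --> T v.

Lemma nuclear_trace H (a b : nat -> H) (B : R) (T : H -> H) : nuclear a b B T ->
  exists l : R[i], [/\ nm l <= B, series (fun k => inner (b k) (a k)) @ \oo --> l
    & forall e, orthonormal_basis e -> series (fun i => inner (e i) (T (e i))) @ \oo --> l].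
Proof.
move=> [abB Tab].
have ab0 k : nm (inner (b k) (a k)) <= nm (a k) * nm (b k) by rewrite mulrC inner_le.
have [l hl] := dominated_series_cvg ab0 abB; exists l; split=> //.
  apply: nm_cvg_le hl; apply: nearW => n; rewrite /series /= big_mkord.
  apply: le_trans (nm_sum _) _; apply: le_trans (abB n).
  exact: ler_sum.
move=> e eB; have eP := orthonormal_basis_psd eB.
(* The partial trace over [e] equals the series of the [inner (b k) (proj n (a k))]. These terms are
   dominated independently of [n] and tend to [inner (b k) (a k)], so Tannery replaces the
   interchange of a double series. *)
pose proj n v := \sum_(i < n) inner (e i) v *: e i.
have [||k|m [hm Sm]] := @tannery R nat \oo _
  (fun n k => inner (b k) (proj n (a k))) (fun k => inner (b k) (a k))
  (series (fun i => inner (e i) (T (e i)))) (fun k => nm (a k) * nm (b k)) B abB.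
- apply: nearW => n k; apply: le_trans (inner_le _ _) _.
  by rewrite mulrC ler_wpM2r ?nm_ge0 ?nm_projection.
- apply: nearW => n.
  have -> : series (fun k => inner (b k) (proj n (a k))) =
    (fun N => \sum_(i < n) inner (e i) (series (fun k => inner (b k) (e i) *: a k) N)).
    apply/funext => N; rewrite /series /= big_mkord.
    under eq_bigr do rewrite inner_sumr.
    rewrite exchange_big big_mkord /=; apply: eq_bigr => k _.
    by rewrite inner_sumr; apply: eq_bigr => i _; rewrite !innerZr mulrC.
  rewrite /series /= big_mkord.
  apply: cvg_sumV => i.
  apply: cvg_inner; exact: Tab.
- apply: cvg_inner; have := parseval (a k) eB; rewrite /series /=.
  by under eq_fun do rewrite big_mkord.
- by rewrite (nm_cvg_unique hl hm).
Qed.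

End BoundedOperators.

Section Traces.
Context {R : realType}.
Implicit Types H K : hilbertType R.

Lemma trace_nuclear H (a b : nat -> H) (B : R) (T : H -> H) :
  separable_hilbert (H := H) -> nuclear a b B T ->
  [/\ series (fun k => inner (b k) (a k)) @ \oo --> trace T, nm (trace T) <= B
    & forall e, orthonormal_basis e ->
        series (fun i => inner (e i) (T (e i))) @ \oo --> trace T].
Proof.
move=> sH /nuclear_trace[l [lB hl he]].
suff -> : trace T = l by [].
by rewrite /trace; apply: cvg_lim; [exact: norm_hausdorff | exact: he (chosen_basisP sH)].
Qed.

Lemma nuclear_compl H K (a : nat -> K) (b : nat -> H) (B C : R) (T : H -> K) (X : K -> K) :
  nuclear a b B T -> bounded_op X -> 0 <= C -> (forall v, nm (X v) <= C * nm v) ->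
  nuclear (X \o a) b (C * B) (X \o T).
Proof.
move=> [abB Tab] Xb C0 XC; split=> [n|v].
  apply: le_trans (ler_wpM2l C0 (abB n)); rewrite mulr_sumr; apply: ler_sum => k _ /=.
  by rewrite mulrA ler_wpM2r ?nm_ge0.
have [XL _] := Xb.
have h : X \o series (fun k => inner (b k) v *: a k) @ \oo --> X (T v).
  by apply: bounded_cvg (Tab v).
suff <- : X \o series (fun k => inner (b k) v *: a k) =
    series (fun k => inner (b k) v *: (X \o a) k) by exact: h.
by apply/funext => n; rewrite /series /= (lin_sum XL); apply: eq_bigr => k _; rewrite (linZ XL).
Qed.

Lemma nuclear_compr H K (e : nat -> H) (a : nat -> K) (b : nat -> H) (B C : R)
    (T : H -> K) (X : H -> H) :
  orthonormal_basis e ->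
  nuclear a b B T -> bounded_op X -> 0 <= C -> (forall v, nm (X v) <= C * nm v) ->
  nuclear a (adjoint X \o b) (C * B) (T \o X).
Proof.
move=> eB [abB Tab] Xb C0 XC; split=> [n|v].
  apply: le_trans (ler_wpM2l C0 (abB n)); rewrite mulr_sumr; apply: ler_sum => k _ /=.
  by rewrite mulrCA ler_wpM2l ?nm_ge0 // (adjoint_bound eB).
have -> : (fun k => inner ((adjoint X \o b) k) v *: a k) =
          (fun k => inner (b k) (X v) *: a k); last exact: Tab.
by apply/funext => k /=; rewrite (adjointP eB).
Qed.

(** Composing on the left moves [X] onto [a k], composing on the right moves its adjoint onto [b k];
    both give the terms [inner (b k) (X (a k))], hence cyclicity. *)
Lemma nuclear_mul H (a b : nat -> H) (B : R) (T X : H -> H) :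
  separable_hilbert (H := H) -> nuclear a b B T -> bounded_op X ->
  series (fun k => inner (b k) (X (a k))) @ \oo --> trace (T \o X) /\
  trace (X \o T) = trace (T \o X).
Proof.
move=> sH Tn Xb; have [_ [C C0 XC]] := iffLR (bounded_opP _) Xb.
have eB := chosen_basisP sH.
have [h1 _ _] := trace_nuclear sH (nuclear_compl Tn Xb C0 XC).
have [h2 _ _] := trace_nuclear sH (nuclear_compr eB Tn Xb C0 XC).
have h3 : series (fun k => inner (b k) (X (a k))) @ \oo --> trace (T \o X).
  have -> : (fun k => inner (b k) (X (a k))) =
            (fun k => inner ((adjoint X \o b) k) (a k)); last by [].
  by apply/funext => k /=; rewrite (adjointP eB).
by split=> //; exact: nm_cvg_unique h1 h3.
Qed.

Lemma nuclear_mul_le H (a b : nat -> H) (B C : R) (T X : H -> H) :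
  separable_hilbert (H := H) -> nuclear a b B T -> bounded_op X ->
  0 <= C -> (forall v, nm (X v) <= C * nm v) ->
  nm (trace (T \o X)) <= C * B.
Proof.
move=> sH Tn Xb C0 XC.
by have [_ ? _] := trace_nuclear sH (nuclear_compr (chosen_basisP sH) Tn Xb C0 XC).
Qed.

Section Decomposition.
Context {H : hilbertType R} {e : nat -> H} {P : H -> H} {B : R}.
Hypotheses (eB : orthonormal_basis e) (Pb : bounded_op P) (P0 : positive_op P).
Hypothesis PB : forall n, \sum_(i < n) complex.Re (inner (e i) (P (e i))) <= B.

Let s u v := inner u (P v).
Let PL : linear P. Proof. by case: Pb. Qed.
Let sP : psd_form s := positive_psd PL P0.
Let f := gs s e.

Lemma positive_residual v : (fun n => nm (P (gs_residual s e n v))) @ \oo --> (0 : R).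
Proof.
have [_ [C C0 PC]] := iffLR (bounded_opP _) Pb.
(* Cauchy-Schwarz for [s] at the pair [P w], [w]: the seminorm of [s] controls [P], and null vectors
   of [s] are killed by [P]. *)
have qP w : nm (P w) ^+ 2 <= C * complex.Re (s w w).
  have [->|w0] := eqVneq (nm (P w)) 0.
    by rewrite expr0n mulr_ge0 // psd_q_ge0.
  have N0 : 0 < nm (P w) ^+ 2 by rewrite exprn_gt0 // lt_def w0 nm_ge0.
  have cs := cauchy_schwarz sP (P w) w.
  rewrite {1}/s inner_diag nmR ger0_norm ?sqr_ge0 // in cs.
  have qPw : complex.Re (s (P w) (P w)) <= C * nm (P w) ^+ 2.
    apply: le_trans (le_trans (ler_norm _) (Re_le_nm _)) _.
    apply: le_trans (inner_le _ _) _.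
    by rewrite expr2 mulrCA ler_wpM2l ?nm_ge0.
  rewrite -(ler_pM2r N0) -[X in X <= _]expr2; apply: (le_trans cs).
  by rewrite mulrAC ler_wpM2r // psd_q_ge0.
have qC w : complex.Re (s w w) <= C * nm w ^+ 2.
  apply: le_trans (le_trans (ler_norm _) (Re_le_nm _)) _.
  apply: le_trans (inner_le _ _) _.
  by rewrite expr2 mulrCA ler_wpM2l ?nm_ge0.
have rL n : linear (gs_residual s e n).
  move=> a u w; rewrite !gs_residualE scalerBr addrACA -opprD; congr (_ - _).
  rewrite scaler_sumr -big_split; apply: eq_bigr => i _ /=.
  by rewrite (psdDr sP) (psdZr sP) scalerDl -scalerA.
(* The residual of the partial expansion [vn n] is null for [s], since each [e i] with [i < n] has
   been processed. Only the residual of [v - vn n] survives under [P], and it is small because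
   [v - vn n] is. *)
pose vn n := \sum_(i < n) inner (e i) v *: e i.
apply: (@squeeze0 _ _ _ _ _ (fun n => C * nm (vn n - v))).
- by move=> n; exact: nm_ge0.
- apply: nearW => n; set z := v - vn n.
  have -> : gs_residual s e n v = gs_residual s e n z + gs_residual s e n (vn n).
    by rewrite -(linD (rL n)) subrK.
  rewrite (linD PL) {2}/vn (lin_sum (rL n)) (lin_sum PL) big1 ?addr0.
    rewrite nmBC -/z -(@ler_pXn2r _ 2) // ?nnegrE ?mulr_ge0 ?nm_ge0 //.
    apply: le_trans (qP _) _; rewrite exprMn expr2 -mulrA ler_wpM2l //.
    apply: le_trans (qC _); rewrite gs_residualE.
    exact: (psd_residual_le sP (gs_orthonormal sP e)).
  move=> i _; rewrite (linZ (rL n)) (linZ PL).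
  have := qP (gs_residual s e n (e i)); rewrite (gs_residual_null sP) // mulr0 => h.
  rewrite (_ : P _ = 0) ?scaler0 //; apply: nm_eq0.
  by apply/eqP; rewrite -sqrf_eq0 eq_le sqr_ge0 andbT.
- rewrite -[X in _ --> X](mulr0 C); apply: cvgMr.
  apply/cvg_nmP; have := parseval v eB.
  suff -> : series (fun i => inner (e i) v *: e i) = vn by [].
  by apply/funext => n; rewrite /series /= big_mkord.
Qed.

(** Parseval in [e] writes the left side as a double sum of squared moduli of [s (f k) (e i)].
    Summing over [k] first, Bessel for [s] leaves the diagonal terms [s (e i) (e i)], that is,
    partial traces of [P]. *)
Lemma positive_gs_bound n : \sum_(k < n) nm (P (f k)) ^+ 2 <= B.
Proof.
have h : (fun I => \sum_(k < n) series (fun i => nm (inner (e i) (P (f k))) ^+ 2) I) @ \oo -->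
   \sum_(k < n) nm (P (f k)) ^+ 2.
  apply: cvg_big => [|k _]; first exact: add_continuous.
  exact: parseval_nm.
apply: (cvgr_to_le h); apply: nearW => I.
apply: le_trans (PB I); rewrite /series /= exchange_big /= big_mkord.
apply: ler_sum => i _; apply: le_trans (bessel sP (gs_orthonormal sP e) n (e i)).
apply: ler_sum => k _; rewrite -nmJ -innerC.
by rewrite (positive_selfadjoint PL P0).
Qed.

End Decomposition.

Lemma modulus_diag_le_trnorm H K (T : H -> K) (P := modulus T) : trace_class T ->
  forall n, \sum_(i < n) complex.Re (inner (chosen_basis H i) (P (chosen_basis H i)))
    <= fine (trnorm T).
Proof.
move=> [_ [[PL _] P0 _] Tfin] n.
have t0 i : 0 <= complex.Re (inner (chosen_basis H i) (P (chosen_basis H i))).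
  exact: (psd_q_ge0 (positive_psd PL P0)).
have fin : trnorm T \is a fin_num.
  by rewrite ge0_fin_numE // nneseries_ge0 // => i _ _; rewrite lee_fin.
rewrite -lee_fin fineK // -sumEFin -(big_mkord xpredT (fun i =>
  (complex.Re (inner (chosen_basis H i) (P (chosen_basis H i))))%:E)).
by apply: nneseries_lim_ge => i _ _; rewrite lee_fin.
Qed.

(* With f a Gram-Schmidt orthonormalization of a basis for the form <u, |T| v>, one has
   |T| v = sum_k <|T| f_k, v> |T| f_k and hence T v = sum_k <|T| f_k, v> T f_k: neither
   the square root of |T| nor the polar decomposition of T is needed. *)
Lemma trace_class_nuclear H K (T : H -> K) :
  separable_hilbert (H := H) -> trace_class T ->
  exists a b, nuclear a b (fine (trnorm T)) T.
Proof.
move=> sH Ttc; have eB := chosen_basisP sH.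
have PB := modulus_diag_le_trnorm Ttc; have [Tb Tm _] := Ttc; have [Pb P0 _] := Tm.
set P := modulus T in PB Tm Pb P0.
have TP v : nm (P v) = nm (T v) := nm_modulus v eB Tb Tm.
have [PL _] := Pb; have [TL _] := Tb; have sP := positive_psd PL P0.
pose f := gs (fun u v => inner u (P v)) (chosen_basis H).
exists (T \o f), (P \o f); split=> [n|v].
  apply: le_trans (positive_gs_bound eB Pb P0 PB n).
  by apply: ler_sum => k _; rewrite /= -TP expr2.
apply/cvg_nmP; apply: (@squeeze0 _ _ _ _ _ _ _ _ (positive_residual eB Pb P0 v)).
  by move=> n; exact: nm_ge0.
apply: nearW => n; rewrite gs_residualE TP (linB TL) nmBC.
rewrite /series /= big_mkord (lin_sum TL).
rewrite (eq_bigr (fun i : 'I_n => T (inner (f i) (P v) *: f i))) //.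
by move=> i _; rewrite (linZ TL (inner (f i) (P v))) (positive_selfadjoint PL P0).
Qed.

(** A density operator is positive, so it can play the role of its own modulus. The expansion is
    then symmetric, which makes each term of Tr[w E(D)] a positive measure in D. The bound 1 is the
    trace. *)
Lemma density_nuclear H (w : H -> H) :
  separable_hilbert (H := H) -> density w -> exists b, nuclear b b 1 w.
Proof.
move=> sH [wtc w0 w1]; have eB := chosen_basisP sH.
have [a0 [b0 wn]] := trace_class_nuclear sH wtc.
have [wb _ _] := wtc; have [wL _] := wb; have sP := positive_psd wL w0.
have [_ _ /(_ _ eB)] := trace_nuclear sH wn; rewrite w1 => /cvg_Re h.
have PB n : \sum_(i < n) complex.Re (inner (chosen_basis H i) (w (chosen_basis H i))) <= 1.
  have -> : \sum_(i < n) complex.Re (inner (chosen_basis H i) (w (chosen_basis H i))) =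
    complex.Re (series (fun i => inner (chosen_basis H i) (w (chosen_basis H i))) n).
    by rewrite /series /= big_mkord cRe_sum.
  have hl := cvg_lim (@Rhausdorff R) h.
  rewrite -[X in _ <= X]/(complex.Re (1 : R[i])) -hl.
  apply: (nondecreasing_cvgn_le _ (cvgP _ h)) => m k mk.
  rewrite -subr_ge0 -cReB sub_series_geq // cRe_sum sumr_ge0 // => i _.
  exact: (psd_q_ge0 sP).
pose f := gs (fun u v => inner u (w v)) (chosen_basis H).
exists (w \o f); split=> [n|v].
  by apply: le_trans (positive_gs_bound eB wb w0 PB n).
apply/cvg_nmP; apply: (@squeeze0 _ _ _ _ _ _ _ _ (positive_residual eB wb w0 v)).
  by move=> n; exact: nm_ge0.
apply: nearW => n; rewrite gs_residualE (linB wL) nmBC.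
rewrite /series /= big_mkord (lin_sum wL).
rewrite (eq_bigr (fun i : 'I_n => w (inner (f i) (w v) *: f i))) //.
by move=> i _; rewrite (linZ wL (inner (f i) (w v))) (positive_selfadjoint wL w0).
Qed.

End Traces.

(** * Rank-one operators *)

Section Ketbra.
Context {R : realType}.
Implicit Types H K : hilbertType R.

Lemma ketbra_bounded H K (u : K) (v : H) : bounded_op (ketbra u v).
Proof.
apply/bounded_opP; split=> [a x y|].
  by rewrite /ketbra innerDr innerZr scalerDl scalerA.
exists (nm v * nm u) => [|z]; first by rewrite mulr_ge0 ?nm_ge0.
by rewrite /ketbra nmZ mulrAC ler_wpM2r ?nm_ge0 ?inner_le.
Qed.

Lemma adjoint_ketbra H K (u : K) (v : H) : adjoint (ketbra u v) = ketbra v u.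
Proof.
apply: adjoint_eq => w z; rewrite /ketbra innerZl innerZr mulrC -innerC mulrC.
by rewrite mulrC.
Qed.

Lemma ketbra_nuclear H K (u : K) (v : H) :
  nuclear (fun k => if k == 0%N then u else 0) (fun k => if k == 0%N then v else 0)
    (nm u * nm v) (ketbra u v).
Proof.
split=> [[|n]|z].
- by rewrite big_ord0 mulr_ge0 ?nm_ge0.
- by rewrite big_ord_recl /= big1 ?addr0 // => i _; rewrite nm0 mul0r.
- apply: cvg_near_cst; exists 1%N => // -[//|n] _.
  by rewrite /series /= big_mkord big_ord_recl /= big1 ?addr0 // => i _; rewrite scaler0.
Qed.

Lemma ketbra_mul H (u v : H) (X : H -> H) : separable_hilbert (H := H) -> bounded_op X ->
  trace (ketbra u v \o X) = inner v (X u) /\ trace (X \o ketbra u v) = inner v (X u).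
Proof.
move=> sH Xb; have [h ->] := nuclear_mul sH (ketbra_nuclear u v) Xb.
suff -> : trace (ketbra u v \o X) = inner v (X u) by [].
apply: (nm_cvg_unique h); apply: cvg_near_cst; exists 1%N => // -[//|n] _.
rewrite /series /= big_mkord big_ord_recl /= big1 ?addr0 // => i _.
by rewrite inner0l.
Qed.

Lemma trace_ketbra H (u v : H) : separable_hilbert (H := H) -> trace (ketbra u v) = inner v u.
Proof. by move=> sH; have [h _] := ketbra_mul u v sH (bounded_id H). Qed.

Lemma trnorm_le H K (T : H -> K) (C : R) : is_modulus T (modulus T) ->
  (forall n, \sum_(i < n)
     complex.Re (inner (chosen_basis H i) (modulus T (chosen_basis H i))) <= C) ->
  (trnorm T <= C%:E)%E.
Proof.
move=> [[PL _] P0 _] TC; rewrite /trnorm.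
apply: lime_le.
  by apply: is_cvg_nneseries => i _ _; rewrite lee_fin (psd_q_ge0 (positive_psd PL P0)).
by apply: nearW => n; rewrite sumEFin lee_fin big_mkord.
Qed.

Lemma zero_bounded H K : bounded_op (fun _ : H => 0 : K).
Proof.
apply/bounded_opP; split=> [a u v|]; first by rewrite scaler0 addr0.
by exists 0 => // v; rewrite nm0 mul0r.
Qed.

Lemma adjoint_zero H K : adjoint (fun _ : H => 0 : K) = fun=> 0.
Proof. by apply: adjoint_eq => w v; rewrite inner0l inner0r. Qed.

Lemma zero_modulus H K : is_modulus (fun _ : H => 0 : K) (modulus (fun _ : H => 0 : K)).
Proof.
rewrite /modulus; apply: (@xgetI _ _ _ (fun=> 0)); split=> //.
- exact: zero_bounded.
- by move=> v; rewrite inner0r.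
- by rewrite adjoint_zero.
Qed.

Lemma zero_trnorm H K : trnorm (fun _ : H => 0 : K) = 0%E.
Proof.
have [[PL _] P0 PP] := zero_modulus H K.
rewrite /trnorm eseries0 // => i _ _; rewrite (_ : modulus _ _ = 0) ?inner0r //.
apply/inner_eq0; rewrite (positive_selfadjoint PL P0) PP adjoint_zero.
exact: inner0r.
Qed.

Lemma zero_trace_class H K : trace_class (fun _ : H => 0 : K).
Proof.
by split; [exact: zero_bounded|exact: zero_modulus|rewrite zero_trnorm].
Qed.

Lemma ketbra_zerol H K (v : H) : ketbra (0 : K) v = fun=> 0.
Proof. by apply/funext => z; rewrite /ketbra scaler0. Qed.

Lemma ketbra_zeror H K (u : K) : ketbra u (0 : H) = fun=> 0.
Proof. by apply/funext => z; rewrite /ketbra inner0l scale0r. Qed.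

Lemma ketbra_modulus H K (u : K) (v : H) : is_modulus (ketbra u v) (modulus (ketbra u v)).
Proof.
have [->|v0] := eqVneq v 0; first by rewrite ketbra_zeror; exact: zero_modulus.
have nv0 : nm v != 0 by apply: contraNneq v0 => /nm_eq0 ->.
(* For T the rank-one operator, T^* T is [nm u ^+ 2] times [ketbra v v], and the square of
   [ketbra v v] is [nm v ^+ 2] times itself; this fixes the factor of the square root. *)
pose c : R[i] := ((nm u / nm v)%:C%C).
rewrite /modulus; apply: (@xgetI _ _ _ (ketbra (c *: v) v)); split.
- exact: ketbra_bounded.
- move=> z; rewrite /ketbra !innerZr mulrCA (innerC v z) mulJ_nm -rmorphM /= ler0c.
  by rewrite mulr_ge0 ?divr_ge0 ?nm_ge0 ?sqr_ge0.
- move=> z; rewrite adjoint_ketbra /ketbra !innerZr !inner_diag scalerA.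
  congr (_ *: _); rewrite -!mulrA; congr (_ * _).
  by rewrite /c -!rmorphM /=; congr (_%:C%C); field.
Qed.

(** These operators are the test elements through which the continuity of [A] and of [V] is
    exploited. As [modulus] is some chosen positive root, finiteness of the trace norm is drawn only
    from its defining equations, which force it to be a multiple of the projection on [v]. *)
Lemma ketbra_trace_class H K (u : K) (v : H) : separable_hilbert (H := H) ->
  trace_class (ketbra u v).
Proof.
move=> sH; have eB := chosen_basisP sH; have eP := orthonormal_basis_psd eB.
have [->|v0] := eqVneq v 0; first by rewrite ketbra_zeror; exact: zero_trace_class.
have [->|u0] := eqVneq u 0; first by rewrite ketbra_zerol; exact: zero_trace_class.
have nv0 : nm v != 0 by apply: contraNneq v0 => /nm_eq0 ->.
have nu0 : nm u != 0 by apply: contraNneq u0 => /nm_eq0 ->.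
have km := ketbra_modulus u v; split=> //; first exact: ketbra_bounded.
have [[PL _] P0 PP] := km; set P := modulus (ketbra u v) in PL P0 PP km.
have PPE z : P (P z) = (inner v z * (nm u ^+ 2)%:C%C) *: v.
  by rewrite PP adjoint_ketbra /ketbra innerZr inner_diag.
(* P commutes with P o P, a multiple of the projection on v. *)
have Pv : P v = (inner v (P v) / (nm v ^+ 2)%:C%C) *: v.
  have := PPE (P v); rewrite (PPE v) (linZ PL) inner_diag => h.
  have n0 : ((nm v ^+ 2)%:C * (nm u ^+ 2)%:C)%C != 0 :> R[i].
    by rewrite -rmorphM /= eq_complex /= eqxx andbT mulf_neq0 ?sqrf_eq0.
  apply: (scalerI n0); rewrite h scalerA; congr (_ *: _).
  have nv : ((nm v ^+ 2)%:C)%C != 0 :> R[i] by rewrite eq_complex /= eqxx andbT sqrf_eq0.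
  move: nv; move: (_%:C%C) (_%:C%C) => t t' nt; by field.
have Pz z : inner z (P z) = (nm (inner v z) ^+ 2)%:C%C * (inner v (P v) / (nm v ^+ 2)%:C%C ^+ 2).
  set a := inner v z / (nm v ^+ 2)%:C%C.
  have nv : ((nm v ^+ 2)%:C)%C != 0 :> R[i] by rewrite eq_complex /= eqxx andbT sqrf_eq0.
  (* By the choice of [a] this vector is orthogonal to [v], hence killed by [P \o P]; by
     self-adjointness it is killed by [P]. *)
  have Pr : P (z - a *: v) = 0.
    apply: inner_eq0; rewrite (positive_selfadjoint PL P0) PPE.
    rewrite innerBr [inner v (_ *: _)]innerZr inner_diag.
    by rewrite divfK // subrr mul0r scale0r inner0r.
  have -> : P z = (a * (inner v (P v) / (nm v ^+ 2)%:C%C)) *: v.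
    by rewrite -scalerA -Pv; apply/eqP; rewrite -subr_eq0 -(linZ PL) -(linB PL) Pr.
  rewrite innerZr -(mulJ_nm (inner v z)) -innerC /a.
  move: nv; move: (_%:C%C) => t nt; by field.
apply: le_lt_trans (ltry _).
apply: (trnorm_le (C := nm v ^+ 2 * nm (inner v (P v) / (nm v ^+ 2)%:C%C ^+ 2))) => //.
move=> n; set D := nm (_ / _ : R[i]).
apply: (@le_trans _ _ ((\sum_(i < n) nm (inner (chosen_basis H i) v) ^+ 2) * D)).
  rewrite mulr_suml; apply: ler_sum => i _; rewrite Pz.
  apply: le_trans (le_trans (ler_norm _) (Re_le_nm _)) _.
  by rewrite nmM nmR ger0_norm ?sqr_ge0 // innerC nmJ.
rewrite ler_wpM2r ?nm_ge0 // -Re_inner_diag; exact: (bessel inner_psd eP).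
Qed.

End Ketbra.

(** * Continuity of the relativization integrand *)

Section Sections.
Context {R : realType} {M : ptopologicalType} {H : hfield R M}.
Implicit Types xi eta : forall x : M, H x.

Lemma csection0 : csection (fun x : M => 0 : H x).
Proof.
have [zeta [cz _]] := hfield_fundamental H.
have := csectionZ 0 (cz 0%N); congr csection; apply: functional_extensionality_dep => x.
by rewrite scale0r.
Qed.

Lemma csectionB xi eta : csection xi -> csection eta -> csection (fun x => xi x - eta x).
Proof.
move=> cx /(csectionZ (-1)) /(csectionD cx); congr csection.
by apply: functional_extensionality_dep => x; rewrite scaleN1r.
Qed.

Lemma csection_sum n (c : 'I_n -> R[i]) (zeta : nat -> forall x, H x) :
  (forall k, csection (zeta k)) -> csection (fun x => \sum_(k < n) c k *: zeta k x).
Proof.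
move=> cz; elim: n c => [|n IH] c.
  have := csection0; congr csection; apply: functional_extensionality_dep => x.
  by rewrite big_ord0.
have := csectionD (IH (fun k => c (widen_ord (leqnSn n) k))) (csectionZ (c ord_max) (cz n)).
by congr csection; apply: functional_extensionality_dep => x; rewrite big_ord_recr.
Qed.

Lemma csection_total x (v : H x) (e : R) : 0 < e ->
  exists2 xi, csection xi & nm (v - xi x) <= e.
Proof.
have [zeta [cz tz]] := hfield_fundamental H.
move=> /(tz x v)[n [c h]]; exists (fun x => \sum_(k < n) c k *: zeta k x).
  exact: csection_sum.
by rewrite -lecR -norm_nm.
Qed.

Lemma fiber_separable x : separable_hilbert (H := H x).
Proof.
have [zeta [_ tz]] := hfield_fundamental H; exists (fun k => zeta k x) => v e e0.
by have [n [c h]] := tz x v e e0; exists n, c; rewrite -lecR -norm_nm.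
Qed.

Lemma csection_nm_continuous xi : csection xi -> continuous (fun x => nm (xi x)).
Proof. by move=> cx x; apply: cvg_Re; apply: csection_norm. Qed.

(** Only norms of sections are continuous by axiom. Polarization gives real parts of inner products,
    and replacing [eta] by [- 'i *: eta] then gives imaginary parts. *)
Lemma csection_Re_continuous xi eta : csection xi -> csection eta ->
  continuous (fun x => complex.Re (inner (xi x) (eta x))).
Proof.
move=> cx ce x.
have -> : (fun x => complex.Re (inner (xi x) (eta x))) =
  (fun x => (nm (xi x) * nm (xi x) + nm (eta x) * nm (eta x) -
    nm (xi x - eta x) * nm (xi x - eta x)) / 2).
  by apply/funext => y; have := nm_sqrB (xi y) (eta y); rewrite !expr2 => ->; field.
have h1 := csection_nm_continuous cx (x := x); have h2 := csection_nm_continuous ce (x := x).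
have h3 := csection_nm_continuous (csectionB cx ce) (x := x).
apply: cvgMl; apply: cvgB; last exact: (cvgM h3 h3).
exact: (cvgD (cvgM h1 h1) (cvgM h2 h2)).
Qed.

Lemma csection_inner_continuous xi eta : csection xi -> csection eta ->
  continuous (fun x => inner (xi x) (eta x)).
Proof.
move=> cx ce x; apply: cvg_ReIm; first exact: csection_Re_continuous.
have -> : (fun x => complex.Im (inner (xi x) (eta x))) =
          (fun x => complex.Re (inner (xi x) (- 'i%C *: eta x))).
  apply/funext => y; rewrite innerZr; case: (inner _ _) => a b /=.
  by ring.
have -> : complex.Im (inner (xi x) (eta x)) = complex.Re (inner (xi x) (- 'i%C *: eta x)).
  rewrite innerZr; case: (inner _ _) => a b /=; by ring.
exact: csection_Re_continuous cx (csectionZ (- 'i%C) ce) x.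
Qed.

Lemma uw_continuous_bounded (A : op_field H) : uw_continuous A ->
  (forall x, bounded_op (A x)) /\
  exists2 C : R, 0 <= C & forall x v, nm (A x v) <= C * nm v.
Proof.
move=> [AL [C AC] _]; split.
  by move=> x; split=> //; exists C.
exists `|C| => // x v; have /op_bounded_nm h := AC x.
by apply: le_trans (h v) _; rewrite ler_wpM2r ?nm_ge0 // ler_norm.
Qed.

Lemma uw_continuous_inner (A : op_field H) xi eta : uw_continuous A ->
  csection xi -> csection eta -> continuous (fun x => inner (eta x) (A x (xi x))).
Proof.
move=> Auw cx ce; have [Ab _] := uw_continuous_bounded Auw; have [_ _ Ac] := Auw.
have -> : (fun x => inner (eta x) (A x (xi x))) =
          (fun x => trace (ketbra (xi x) (eta x) \o A x)).
  by apply/funext => x; have [-> _] := ketbra_mul (xi x) (eta x) (@fiber_separable x) (Ab x).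
apply: Ac; split=> [x|x0 e e0]; first by apply: ketbra_trace_class; exact: fiber_separable.
exists setT, (fun x => ketbra (xi x) (eta x)); split; first exact: filterT.
- exists 1%N, (fun=> xi), (fun=> eta); split=> // x v; by rewrite big_ord1.
- move=> x _; rewrite (_ : (fun v => _) = fun=> 0) ?zero_trnorm ?lee_fin ?ltW //.
  by apply/funext => v; rewrite subrr.
Qed.

(** Over the target fibre of [x] only the value at [x] matters, so extension by 0 is harmless.
    Evaluating a field at [tgt G b] takes the place of a transport along [tgt G b = x]. *)
Lemma vector_field_extension x (v : H x) : exists w : forall y, H y, w x = v.
Proof.
exists (fun y => if pselect (x = y) is left e then transport e v else 0).
by case: pselect => // e; rewrite (Prop_irrelevance e erefl).
Qed.

End Sections.

Section Unitary.
Context {R : realType} {H K : hilbertType R} {U : H -> K}.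
Hypothesis Uu : unitary U.

Lemma unitary_nm v : nm (U v) = nm v.
Proof.
case: Uu => _ iU _; apply/eqP.
by rewrite -(@eqrXn2 _ 2) ?nm_ge0 // -!Re_inner_diag iU.
Qed.

Lemma unitary_adjoint w v : inner (adjoint U w) v = inner w (U v).
Proof.
case: Uu => UL iU /choice[S US].
by rewrite (@adjoint_eq _ _ _ U S) => [|{}w {}v]; rewrite -iU US.
Qed.

Lemma unitaryK w : U (adjoint U w) = w.
Proof.
case: Uu => UL iU /(_ w)[v vw].
by rewrite -vw; congr U; apply: inner_inj => z; rewrite innerC unitary_adjoint iU -innerC.
Qed.

Lemma unitary_adjoint_nm w : nm (adjoint U w) = nm w.
Proof. by rewrite -unitary_nm unitaryK. Qed.

Lemma unitary_adjoint_linear : linear (adjoint U).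
Proof.
move=> a u v; case: Uu => UL _ _; apply: inner_inj => z.
by rewrite innerC unitary_adjoint innerDl innerZl -!unitary_adjoint -innerZl -innerDl -innerC.
Qed.

Lemma unitary_bounded : bounded_op U.
Proof.
case: Uu => UL _ _; apply/bounded_opP; split=> //; exists 1 => // v.
by rewrite mul1r unitary_nm.
Qed.

Lemma unitary_adjoint_bounded : bounded_op (adjoint U).
Proof.
apply/bounded_opP; split; first exact: unitary_adjoint_linear.
by exists 1 => // v; rewrite mul1r unitary_adjoint_nm.
Qed.

Lemma unitary_adjoint_sub w v : nm (adjoint U w - v) = nm (w - U v).
Proof.
case: Uu => UL _ _.
by rewrite -unitary_nm (linB UL) unitaryK.
Qed.

End Unitary.

Section SystemContinuity.
Context {R : realType} {Gm M : ptopologicalType} {G : groupoid Gm M} {S : gsystem R G}.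
Let H := sys_field S.
Let V := sys_rep S.
Implicit Types (xi eta : forall x : M, H x) (A : op_field H).

Lemma rep_inner_continuous xi eta : csection xi -> csection eta ->
  continuous (fun a => inner (eta (tgt G a)) (V a (xi (src G a)))).
Proof.
move=> cx ce.
have sH x : separable_hilbert (H := H x) := @fiber_separable _ _ H x.
have -> : (fun a => inner (eta (tgt G a)) (V a (xi (src G a)))) =
  (fun a => trace (V a \o ketbra (xi (src G a)) (eta (tgt G a)))).
  apply/funext => a; rewrite -trace_ketbra //; congr trace; apply/funext => v.
  by have [VL _ _] := urep_unitary V a; rewrite /= /ketbra (linZ VL).
apply: sys_rep_continuous => [a|a0]; first exact: ketbra_trace_class.
exists setT; first exact: filterT.
move=> e e0; exists (fun a => ketbra (xi (src G a)) (eta (tgt G a))).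
  by exists 1%N, (fun=> xi), (fun=> eta); split=> // a v; rewrite big_ord1.
move=> a _; rewrite (_ : (fun v => _) = fun=> 0) ?zero_trnorm ?lee_fin ?ltW //.
by apply/funext => v; rewrite subrr.
Qed.

Definition pullback (w : forall x, H x) (b : Gm) : H (src G b) :=
  adjoint (V b) (w (tgt G b)).

(** This covers two situations at once: an arbitrary field on one target fibre, where it is a single
    vector, and a continuous section on all of [Gm]. The first is used for continuity on a fibre,
    the second for joint measurability. *)
Definition section_approx (D : set Gm) (w : forall x, H x) :=
  forall e : R, 0 < e -> exists2 eta, csection eta &
    forall b, D b -> nm (w (tgt G b) - eta (tgt G b)) <= e.

Lemma section_approx_csection eta : csection eta -> section_approx setT eta.
Proof. by move=> ce e e0; exists eta => // b _; rewrite subrr nm0 ltW. Qed.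

Lemma section_approx_fiber x (w : forall x, H x) : section_approx (tfiber G x) w.
Proof.
move=> e e0; have [eta ce h] := csection_total (w x) e0.
by exists eta => // b; rewrite /tfiber /= => ->.
Qed.

Lemma pullback_approx D w b0 (e : R) : section_approx D w -> D b0 -> 0 < e ->
  exists2 xi, csection xi &
    \forall b \near b0, D b -> nm (pullback w b - xi (src G b)) <= e.
Proof.
move=> wD Db0 e0; have e8 : 0 < e / 8 by rewrite divr_gt0.
have [eta ce he] := wD _ e8.
have [xi cx hx] := csection_total (pullback w b0) e8.
exists xi => //.
(* The square of [N b] expands into norms of continuous sections and one matrix coefficient of [V],
   because [V b] preserves norms; so it is continuous. Two errors of [e / 8] give [N b0 <= e / 4],
   hence [N b < e / 2] nearby. *)
pose N b := nm (eta (tgt G b) - V b (xi (src G b))).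
have N0 : N b0 <= e / 4.
  rewrite /N -(subrKA (w (tgt G b0))); apply: le_trans (nmD _ _) _.
  rewrite -(unitary_adjoint_sub (urep_unitary V b0)) nmBC.
  have := he _ Db0; rewrite /pullback in hx; lra.
have Nc : (fun b => N b ^+ 2) @ b0 --> N b0 ^+ 2.
  have -> : (fun b => N b ^+ 2) = (fun b => nm (eta (tgt G b)) * nm (eta (tgt G b))
      - complex.Re (inner (eta (tgt G b)) (V b (xi (src G b)))) *+ 2
      + nm (xi (src G b)) * nm (xi (src G b))).
    by apply/funext => b; rewrite /N nm_sqrB (unitary_nm (urep_unitary V b)) !expr2.
  rewrite /N nm_sqrB (unitary_nm (urep_unitary V b0)) !expr2.
  have h1 : (fun b => nm (eta (tgt G b))) @ b0 --> nm (eta (tgt G b0)).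
    apply: (@continuous_comp _ _ _ (tgt G) (fun x => nm (eta x)) b0);
      [exact: tgt_continuous | exact: csection_nm_continuous].
  have h2 : (fun b => nm (xi (src G b))) @ b0 --> nm (xi (src G b0)).
    apply: (@continuous_comp _ _ _ (src G) (fun x => nm (xi x)) b0);
      [exact: src_continuous | exact: csection_nm_continuous].
  have h3 : (fun b => complex.Re (inner (eta (tgt G b)) (V b (xi (src G b))))) @ b0 -->
      complex.Re (inner (eta (tgt G b0)) (V b0 (xi (src G b0)))).
    by apply: cvg_Re; exact: rep_inner_continuous.
  exact: (cvgD (cvgB (cvgM h1 h1) (cvgD h3 h3)) (cvgM h2 h2)).
have Nb : N b0 ^+ 2 < (e / 2) ^+ 2.
  by rewrite ltr_pXn2r ?nnegrE ?nm_ge0 ?divr_ge0 ?(ltW e0) //; lra.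
have nN : \forall b \near b0, N b ^+ 2 < (e / 2) ^+ 2 by exact: (cvgr_lt _ Nc).
apply: filterS nN => b hb Db.
rewrite ltr_pXn2r ?nnegrE ?nm_ge0 ?divr_ge0 ?(ltW e0) // in hb.
rewrite (unitary_adjoint_sub (urep_unitary V b)) -(subrKA (eta (tgt G b))).
apply: le_trans (nmD _ _) _; have := he _ Db; rewrite /N in hb; lra.
Qed.

Definition integrand A (v w : forall x, H x) (b : Gm) : R[i] :=
  inner (pullback v b) (A (src G b) (pullback w b)).

Lemma integrandE A v w b :
  integrand A v w b =
    inner (v (tgt G b)) ((V b \o A (src G b) \o adjoint (V b)) (w (tgt G b))).
Proof. by rewrite /integrand /pullback (unitary_adjoint (urep_unitary V b)). Qed.

Lemma integrand_le A (C : R) v w b : 0 <= C -> (forall x u, nm (A x u) <= C * nm u) ->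
  nm (integrand A v w b) <= C * (nm (v (tgt G b)) * nm (w (tgt G b))).
Proof.
move=> C0 AC; apply: le_trans (inner_le _ _) _.
rewrite -(unitary_adjoint_nm (urep_unitary V b) (v _)).
rewrite -(unitary_adjoint_nm (urep_unitary V b) (w _)) mulrCA.
by rewrite ler_wpM2l ?nm_ge0.
Qed.

(** Both pulled-back vectors are replaced, in norm, by continuous sections near [src G b0]; only
    then does the weak continuity of [A] apply, composed with [src G]. *)
Lemma integrand_cvg A D v w b0 : uw_continuous A ->
  section_approx D v -> section_approx D w -> D b0 ->
  integrand A v w @ within D (nbhs b0) --> integrand A v w b0.
Proof.
move=> Auw vD wD Db0; have [Ab [C C0 AC]] := uw_continuous_bounded Auw.
apply/cvg_nm_near => e e0.
(* The 5 collects unit errors: one for each passage from a pulled-back vector to its section at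
   [b0], one for each move of a section from [b0] to [b], and one for the return to
   [pullback w b]. *)
pose K := nm (pullback v b0) + nm (pullback w b0) + 5.
have K0 : 0 < K by rewrite /K; have := nm_ge0 (pullback v b0); have := nm_ge0 (pullback w b0); lra.
have CK0 : 0 < C * K + 1 by rewrite ltr_wpDl // mulr_ge0 // ltW.
(* The replacement error is at most [d * (C * K)]; the [+ 1] keeps the denominator positive when
   [C = 0]. *)
pose d := Num.min 1 (e / (3 * (C * K + 1))).
have d0 : 0 < d by rewrite lt_min ltr01 divr_gt0 // mulr_gt0.
have d1 : d <= 1 by rewrite ge_min lexx.
have dK : d * (C * K) <= e / 3.
  apply: (@le_trans _ _ (d * (C * K + 1))); first by rewrite ler_wpM2l ?ltW // ltrDl.
  rewrite -ler_pdivlMr //; apply: (@le_trans _ _ (e / (3 * (C * K + 1)))).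
    by rewrite ge_min lexx orbT.
  by rewrite invfM mulrA.
have [xi cx hx] := pullback_approx vD Db0 d0.
have [zeta cz hz] := pullback_approx wD Db0 d0.
pose g b := inner (xi (src G b)) (A (src G b) (zeta (src G b))).
have gc : g @ b0 --> g b0.
  apply: (@continuous_comp _ _ _ (src G) (fun x => inner (xi x) (A x (zeta x))) b0);
    [exact: src_continuous | exact: uw_continuous_inner].
have diff b : D b -> nm (pullback v b - xi (src G b)) <= d ->
    nm (pullback w b - zeta (src G b)) <= d ->
    nm (xi (src G b)) + nm (pullback w b) <= K ->
    nm (integrand A v w b - g b) <= e / 3.
  move=> Db h1 h2 h3; have [AL _] := Ab (src G b).
  have -> : integrand A v w b - g b =
      inner (pullback v b - xi (src G b)) (A _ (pullback w b)) +
      inner (xi (src G b)) (A _ (pullback w b - zeta (src G b))).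
    by rewrite innerBl (linB AL) innerBr addrA subrK.
  apply: le_trans (nmD _ _) _; apply: le_trans _ dK.
  apply: (@le_trans _ _ (d * (C * nm (pullback w b)) + nm (xi (src G b)) * (C * d))).
    apply: lerD; apply: le_trans (inner_le _ _) _.
      by apply: ler_pM; rewrite ?nm_ge0.
    by rewrite ler_wpM2l ?nm_ge0 //; apply: le_trans (AC _ _) _; rewrite ler_wpM2l.
  rewrite (_ : _ + _ = d * (C * (nm (xi (src G b)) + nm (pullback w b)))); last by ring.
  by rewrite ler_wpM2l ?(ltW d0) // ler_wpM2l.
have nc (x : forall x, H x) : csection x ->
    \forall b \near b0, nm (x (src G b)) <= nm (x (src G b0)) + 1.
  move=> cxx; have h : (fun b => nm (x (src G b))) @ b0 --> nm (x (src G b0)).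
    apply: (@continuous_comp _ _ _ (src G) (fun y => nm (x y)) b0);
      [exact: src_continuous | exact: csection_nm_continuous].
  by apply: (cvgr_le _ h); rewrite ltrDl.
have hx0 := nbhs_singleton hx Db0; have hz0 := nbhs_singleton hz Db0.
have tri (y : M) (u v' : H y) : nm u <= nm v' + nm (u - v').
  by rewrite -{1}(subrK v' u) addrC; exact: nmD.
have d3 : nm (integrand A v w b0 - g b0) <= e / 3.
  apply: diff => //; rewrite /K.
  have := tri _ (xi (src G b0)) (pullback v b0); rewrite nmBC in hx0.
  have := nm_ge0 (pullback w b0); lra.
have e3 : 0 < e / 3 by rewrite divr_gt0.
move/cvg_nm_near : gc => /(_ _ e3) gc.
rewrite near_withinE; near=> b => Db.
have h1 : nm (pullback v b - xi (src G b)) <= d by move: Db; near: b.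
have h2 : nm (pullback w b - zeta (src G b)) <= d by move: Db; near: b.
have h3 : nm (g b - g b0) <= e / 3 by near: b.
have h4 : nm (xi (src G b)) <= nm (xi (src G b0)) + 1 by near: b; exact: nc.
have h5 : nm (zeta (src G b)) <= nm (zeta (src G b0)) + 1 by near: b; exact: nc.
have d2 : nm (integrand A v w b - g b) <= e / 3.
  apply: diff => //; rewrite /K.
  have t1 := tri _ (xi (src G b0)) (pullback v b0); rewrite nmBC in t1.
  have t2 := tri _ (zeta (src G b0)) (pullback w b0); rewrite nmBC in t2.
  have t3 := tri _ (pullback w b) (zeta (src G b)); lra.
have -> : integrand A v w b - integrand A v w b0 =
   (integrand A v w b - g b) + ((g b - g b0) - (integrand A v w b0 - g b0)).
  by rewrite opprB addrA !subrKA.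
apply: le_trans (nmD _ _) _.
have := nmD (g b - g b0) (- (integrand A v w b0 - g b0)); rewrite nmN; lra.
Unshelve. all: by end_near. Qed.

End SystemContinuity.

(** * Complex integrals on Borel spaces *)

Section BorelIntegrals.
Context {R : realType} {X : ptopologicalType}.
Implicit Types (D : set X) (f g : X -> R[i]).

Lemma open_borel D : open D -> measurable (D : set (borel X)).
Proof. by move=> oD; apply: sub_gen_smallest. Qed.

Lemma closed_borel D : closed D -> measurable (D : set (borel X)).
Proof.
by move=> cD; rewrite -[D]setCK; apply: measurableC; apply: open_borel; exact: closed_openC.
Qed.

Lemma within_continuous_measurable D (f : X -> R) : measurable (D : set (borel X)) ->
  {within D, continuous f} -> measurable_fun (D : set (borel X)) f.
Proof.
move=> mD /continuousP cf; apply: (measurability _ (RGenOpens.measurableE R)).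
move=> _ [_ [a [b ->] <-]].
have oab : open (`]a, b[%classic : set R) by exact: interval_open.
have /open_subspaceP[V oV VD] := cf _ oab.
by rewrite setIC -VD; apply: measurableI => //; exact: open_borel.
Qed.

Definition cmeasurable_on D f :=
  measurable_fun (D : set (borel X)) (fun y => complex.Re (f y)) /\
  measurable_fun (D : set (borel X)) (fun y => complex.Im (f y)).

Definition cbounded_on D f := exists c : R, forall y, D y -> nm (f y) <= c.

Lemma within_cvg_cmeasurable D f : measurable (D : set (borel X)) ->
  (forall y, D y -> f @ within D (nbhs y) --> f y) -> cmeasurable_on D f.
Proof.
move=> mD fc; split; apply: within_continuous_measurable => //;
  apply/subspace_continuousP => y Dy.
- by apply: cvg_Re; exact: fc.
- by apply: cvg_Im; exact: fc.
Qed.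

Lemma cmeasurable_onD D f g : cmeasurable_on D f -> cmeasurable_on D g ->
  cmeasurable_on D (fun y => f y + g y).
Proof.
move=> [fr fi] [gr gi]; split.
- under eq_fun do rewrite cReD; exact: measurable_funD.
- under eq_fun do rewrite cImD; exact: measurable_funD.
Qed.

Lemma cmeasurable_onM D f g : cmeasurable_on D f -> cmeasurable_on D g ->
  cmeasurable_on D (fun y => f y * g y).
Proof.
move=> [fr fi] [gr gi]; split.
- under eq_fun do rewrite cReM; apply: measurable_funB; exact: measurable_funM.
- under eq_fun do rewrite cImM; apply: measurable_funD; exact: measurable_funM.
Qed.

Lemma cmeasurable_on_cst D (c : R[i]) : cmeasurable_on D (fun=> c).
Proof. by split; exact: measurable_cst. Qed.

Lemma cmeasurable_on_cvg D (g : nat -> X -> R[i]) f :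
  (forall n, cmeasurable_on D (g n)) -> (forall y, D y -> g ^~ y @ \oo --> f y) ->
  cmeasurable_on D f.
Proof.
move=> gm gf; split.
- apply/measurable_EFinP.
  apply: (@emeasurable_fun_cvg _ (borel X) R D (fun n y => (complex.Re (g n y))%:E)).
    by move=> n; apply/measurable_EFinP; case: (gm n).
  move=> y Dy; apply: cvg_EFin; first exact: nearW.
  by apply: cvg_Re; exact: gf.
- apply/measurable_EFinP.
  apply: (@emeasurable_fun_cvg _ (borel X) R D (fun n y => (complex.Im (g n y))%:E)).
    by move=> n; apply/measurable_EFinP; case: (gm n).
  move=> y Dy; apply: cvg_EFin; first exact: nearW.
  by apply: cvg_Im; exact: gf.
Qed.

Section Bounded.
Variables (m : {measure set (borel X) -> \bar R}) (D : set X).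
Hypotheses (mD : measurable (D : set (borel X))) (Dfin : (m D < +oo)%E).

Lemma cbounded_integrable f : cmeasurable_on D f -> cbounded_on D f -> cintegrable m D f.
Proof.
move=> [fr fi] [c fc]; split; apply: measurable_bounded_integrable => //;
  exists c; split; rewrite ?num_real // => k ck y Dy.
- exact: le_trans (Re_le_nm _) (le_trans (fc _ Dy) (ltW ck)).
- exact: le_trans (Im_le_nm _) (le_trans (fc _ Dy) (ltW ck)).
Qed.

Lemma Rintegral_bound (h : X -> R) (c : R) :
  m.-integrable D (EFin \o h) -> (forall y, D y -> `|h y| <= c) ->
  `|\int[m]_(y in D) h y| <= c * fine (m D).
Proof.
move=> hi hc; apply: le_trans (le_normr_Rintegral mD hi) _.
rewrite -Rintegral_cst //; apply: le_Rintegral => //.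
- exact: (integrable_norm hi).
- apply: (@measurable_bounded_integrable _ (borel X) R m (fun=> c)) => //.
  exists `|c|; split; rewrite ?num_real // => k ck y Dy; exact: ltW.
Qed.

(* The factor 2 comes from bounding the real and imaginary parts separately; no sharp
   constant is needed. *)
Lemma cintegral_bound f (c : R) : cintegrable m D f ->
  (forall y, D y -> nm (f y) <= c) -> nm (cintegral m D f) <= 2 * (c * fine (m D)).
Proof.
move=> [fr fi] fc; apply: le_trans (nm_le_ReIm _) _; rewrite mulrDl mul1r.
apply: lerD; apply: Rintegral_bound => // y /fc; apply: le_trans.
- exact: Re_le_nm.
- exact: Im_le_nm.
Qed.

Lemma cintegralD f g : cintegrable m D f -> cintegrable m D g ->
  cintegral m D (fun y => f y + g y) = cintegral m D f + cintegral m D g.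
Proof.
move=> [fr fi] [gr gi]; apply/eqP; rewrite eq_complex /=; apply/andP; split; apply/eqP.
- by under eq_Rintegral do rewrite cReD; rewrite RintegralD.
- by under eq_Rintegral do rewrite cImD; rewrite RintegralD.
Qed.

Let Zl (r : R) (h : X -> R) : m.-integrable D (EFin \o h) ->
  m.-integrable D (EFin \o (fun y => r * h y)).
Proof. by move=> hi; apply: (eq_integrable mD _ _ _ (integrableZl mD r hi)). Qed.

Lemma cintegrableZ (a : R[i]) f : cintegrable m D f -> cintegrable m D (fun y => a * f y).
Proof.
move=> [fr fi]; split.
- under eq_fun do rewrite cReM EFinB; apply: integrableB => //; exact: Zl.
- under eq_fun do rewrite cImM EFinD; apply: integrableD => //; exact: Zl.
Qed.

Lemma cintegralZ (a : R[i]) f : cintegrable m D f ->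
  cintegral m D (fun y => a * f y) = a * cintegral m D f.
Proof.
move=> [fr fi].
apply/eqP; rewrite eq_complex /cintegral cReM cImM /=; apply/andP; split; apply/eqP.
- under eq_Rintegral do rewrite cReM.
  rewrite RintegralB //; [|exact: Zl|exact: Zl]; by rewrite !RintegralZl.
- under eq_Rintegral do rewrite cImM.
  rewrite RintegralD //; [|exact: Zl|exact: Zl]; by rewrite !RintegralZl.
Qed.

Lemma cintegrableD f g : cintegrable m D f -> cintegrable m D g ->
  cintegrable m D (fun y => f y + g y).
Proof.
move=> [fr fi] [gr gi]; split.
- under eq_fun do rewrite cReD EFinD; exact: integrableD.
- under eq_fun do rewrite cImD EFinD; exact: integrableD.
Qed.

Lemma eq_cintegral f g : (forall y, D y -> f y = g y) -> cintegral m D f = cintegral m D g.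
Proof.
by move=> fg; congr Complex; apply: eq_Rintegral => y /set_mem Dy; rewrite fg.
Qed.

Lemma eq_cintegrable f g : (forall y, D y -> f y = g y) ->
  cintegrable m D f -> cintegrable m D g.
Proof.
move=> fg [fr fi]; split.
- by apply: (eq_integrable mD _ _ _ fr) => y /set_mem Dy; rewrite fg.
- by apply: (eq_integrable mD _ _ _ fi) => y /set_mem Dy; rewrite fg.
Qed.

Lemma cintegral_sum n (g : nat -> X -> R[i]) : (forall k, cintegrable m D (g k)) ->
  cintegrable m D (fun y => \sum_(k < n) g k y) /\
  cintegral m D (fun y => \sum_(k < n) g k y) = \sum_(k < n) cintegral m D (g k).
Proof.
move=> gi; elim: n => [|n [IHi IH]].
  under eq_fun do rewrite big_ord0; rewrite big_ord0; split.
    by split; exact: integrable0.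
  by rewrite /cintegral /= /Rintegral integral0.
under eq_fun do rewrite big_ord_recr; rewrite big_ord_recr /=; split.
  exact: cintegrableD.
by rewrite cintegralD // IH.
Qed.

(** The remainders are bounded on [D] by the tails of [beta], so convergence is uniform, and the
    measure of [D] is finite. *)
Lemma cintegral_series (g : nat -> X -> R[i]) f (beta : nat -> R) (B : R) :
  (forall k, cmeasurable_on D (g k)) -> cmeasurable_on D f ->
  (forall k y, D y -> nm (g k y) <= beta k) -> (forall n, \sum_(k < n) beta k <= B) ->
  (forall k, 0 <= beta k) ->
  (forall y, D y -> series (g ^~ y) @ \oo --> f y) ->
  series (fun k => cintegral m D (g k)) @ \oo --> cintegral m D f.
Proof.
move=> gm fm gb bB b0 gf.
have gi k : cintegrable m D (g k).
  by apply: cbounded_integrable => //; exists (beta k) => y; exact: gb.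
have fi : cintegrable m D f.
  apply: cbounded_integrable => //; exists B => y Dy.
  apply: nm_cvg_le (gf _ Dy); apply: nearW => n; rewrite /series /= big_mkord.
  by apply: le_trans (nm_sum _) _; apply: le_trans (bB n); apply: ler_sum => k _; exact: gb.
have bc := bounded_series_cvg b0 bB.
set b := limn (series beta) in bc.
apply/cvg_nmP; apply: (@squeeze0 _ _ _ _ _ (fun n => 2 * ((b - series beta n) * fine (m D)))).
- by move=> n; exact: nm_ge0.
- apply: nearW => n.
  have [si sE] := cintegral_sum n gi.
  rewrite nmBC /series /= big_mkord -sE -[- cintegral _ _ _]mulN1r -cintegralZ //.
  rewrite -cintegralD //; last exact: cintegrableZ.
  apply: cintegral_bound; first by apply: cintegrableD => //; exact: cintegrableZ.
  move=> y Dy; rewrite mulN1r.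
  have := @series_tail_le _ (g ^~ y) beta b (f y) n (fun k => gb k y Dy) (gf _ Dy) bc.
  by rewrite /series /= !big_mkord.
- have -> : 0 = 2 * ((b - b) * fine (m D)) by rewrite subrr mul0r mulr0.
  apply: cvgMr; apply: cvgMl; apply: cvgB; [exact: cvg_cst|exact: bc].
Qed.

End Bounded.
End BorelIntegrals.

(** * POVM measures and the relativization at a point *)

(** Closedness comes from points of [Gm]: since [src G] is a left inverse of [gid G], the fibre is
    the preimage of the single arrow [gid G x] under [gid G \o tgt G]. *)
Lemma tfiber_closed (Gm M : ptopologicalType) (G : groupoid Gm M) (x : M) :
  hausdorff_space Gm -> closed (tfiber G x).
Proof.
move=> hG; have -> : tfiber G x = (gid G \o tgt G) @^-1` [set gid G x].
  apply/seteqP; split=> b; rewrite /tfiber /=; first by move=> ->.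
  by move/(congr1 (src G)); rewrite !src_id.
apply: closed_comp.
  move=> b _; apply: continuous_comp; [exact: tgt_continuous | exact: gid_continuous].
exact/accessible_closed_set1/hausdorff_accessible.
Qed.

Section PovmMeasure.
Context {R : realType} {Gm M : ptopologicalType} {G : groupoid Gm M} (F : qrf R G).
Hypothesis Gm_hausdorff : hausdorff_space Gm.
Let H := qrf_field F.

Lemma tfiber_borel x : measurable (tfiber G x : set (borel Gm)).
Proof. by apply: closed_borel; exact: tfiber_closed. Qed.

Lemma fiber_part_borel x (D : set Gm) : measurable (D : set (borel Gm)) ->
  measurable (D `&` tfiber G x : set (borel Gm)) /\ D `&` tfiber G x `<=` tfiber G x.
Proof. by move=> mD; split; [apply: measurableI => //; exact: tfiber_borel | move=> b []]. Qed.

Lemma povm_bounded x (D : set Gm) : measurable (D : set (borel Gm)) ->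
  bounded_op (qrf_povm F x (D `&` tfiber G x)).
Proof. by move=> /fiber_part_borel -/(_ x)[m1 m2]; case: (povm_effect F m1 m2). Qed.

Lemma povm_positive x (D : set Gm) : measurable (D : set (borel Gm)) ->
  positive_op (qrf_povm F x (D `&` tfiber G x)).
Proof. by move=> /fiber_part_borel -/(_ x)[m1 m2]; case: (povm_effect F m1 m2). Qed.

Section VectorMeasure.
Variables (x : M) (v : H x).

(* Only Borel sets matter; the POVM is arbitrary on the other ones. *)
Definition vector_povm (D : set (borel Gm)) : \bar R :=
  if pselect (measurable D) then (complex.Re (inner v (qrf_povm F x (D `&` tfiber G x) v)))%:E
  else 0%E.

Lemma vector_povmE D : measurable D ->
  vector_povm D = (complex.Re (inner v (qrf_povm F x (D `&` tfiber G x) v)))%:E.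
Proof. by rewrite /vector_povm; case: pselect. Qed.

Let vector_povm_additive (D : nat -> set (borel Gm)) : (forall k, measurable (D k)) ->
  trivIset setT D ->
  series (fun k => complex.Re (inner v (qrf_povm F x (D k `&` tfiber G x) v))) @ \oo -->
    complex.Re (inner v (qrf_povm F x (\bigcup_k D k `&` tfiber G x) v)).
Proof.
move=> mD tD; have h : series (fun k => inner v (qrf_povm F x (D k `&` tfiber G x) v)) @ \oo -->
    inner v (qrf_povm F x (\bigcup_k D k `&` tfiber G x) v).
  rewrite setI_bigcupl; apply: povm_sigma_additive; first by move=> k; exact: fiber_part_borel.
  exact: trivIset_setIr.
have -> : series (fun k => complex.Re (inner v (qrf_povm F x (D k `&` tfiber G x) v))) =
   (fun n => complex.Re (series (fun k => inner v (qrf_povm F x (D k `&` tfiber G x) v)) n)).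
  by apply/funext => n; rewrite /series /= cRe_sum.
exact: cvg_Re.
Qed.

Let vector_povm0 : vector_povm set0 = 0%E.
Proof.
rewrite vector_povmE //; congr EFin.
(* On a sequence of empty sets additivity makes a series with constant terms converge, so that the
   term is 0. *)
have h := @vector_povm_additive (fun=> set0) (fun=> measurable0) _.
have /h {}h : trivIset setT (fun _ : nat => set0 : set (borel Gm)).
  by apply/trivIsetP => i j _ _ _; rewrite set0I.
have /cvg_series_cvg_0 := cvgP _ h.
by move/(cvg_lim (@Rhausdorff R)); rewrite lim_cst.
Qed.

Let vector_povm_ge0 D : (0 <= vector_povm D)%E.
Proof.
have [mD|nD] := pselect (measurable D); last by rewrite /vector_povm; case: pselect.
rewrite vector_povmE // lee_fin.
have [PL _] := povm_bounded x mD.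
exact: (psd_q_ge0 (positive_psd PL (@povm_positive x D mD))).
Qed.

Let vector_povm_sigma_additive : semi_sigma_additive vector_povm.
Proof.
move=> D mD tD mUD; rewrite vector_povmE //.
under eq_fun do (under eq_bigr do rewrite vector_povmE //; rewrite sumEFin).
apply: cvg_EFin; first exact: nearW.
exact: vector_povm_additive.
Qed.

HB.instance Definition _ := isMeasure.Build _ (borel Gm) R vector_povm
  vector_povm0 vector_povm_ge0 vector_povm_sigma_additive.

Definition vector_povm_measure : {measure set (borel Gm) -> \bar R} := vector_povm.

End VectorMeasure.

(** The symmetric expansion of [w] exhibits the required measure as a countable sum of vector
    measures, so the default [mzero] is never taken for a density operator. *)
Lemma povm_measureP x (w : H x -> H x) : density w -> is_povm_measure w (povm_measure w).
Proof.
move=> wd; suff ex : exists m, is_povm_measure w m.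
  by rewrite /povm_measure; case: pselect => // ex'; case: (cid ex').
have sH := @fiber_separable _ _ H x.
have [b wn] := density_nuclear sH wd.
exists (mseries (fun k => vector_povm_measure (b k)) 0) => D mD.
have [h _] := nuclear_mul sH wn (povm_bounded x mD).
rewrite /mseries; apply: cvg_lim => //.
under eq_fun do (under eq_bigr do rewrite /= vector_povmE //; rewrite sumEFin).
apply: cvg_EFin; first exact: nearW.
rewrite (_ : fine \o _ =
  (fun n => complex.Re (series (fun k => inner (b k) (qrf_povm F x (D `&` tfiber G x) (b k))) n))).
  exact: cvg_Re.
by apply/funext => n; rewrite /series /= cRe_sum.
Qed.

Lemma povm_measure_fiber x (w : H x -> H x) : density w ->
  povm_measure w (tfiber G x) = 1%E.
Proof.
move=> wd; rewrite povm_measureP //; last exact: tfiber_borel.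
rewrite setIid (_ : w \o _ = w); last by apply/funext => v /=; rewrite povm_normalized.
by case: wd => _ _ ->.
Qed.

Lemma povm_measure_outside x (w : H x -> H x) : density w ->
  povm_measure w (~` tfiber G x) = 0%E.
Proof.
move=> wd; have mf := tfiber_borel x.
have mT : povm_measure w setT = 1%E.
  rewrite povm_measureP // setTI (_ : w \o _ = w).
    by case: wd => _ _ ->.
  by apply/funext => v /=; rewrite povm_normalized.
have : povm_measure w setT = (povm_measure w (tfiber G x) + povm_measure w (~` tfiber G x))%E.
  rewrite -[X in povm_measure w X](setUv (tfiber G x)).
  exact: (measureU _ mf (measurableC mf) (setICr _)).
rewrite mT povm_measure_fiber // => /(congr1 (fun z => (z - 1%:E)%E)).
by rewrite addeAC subee // add0e => <-.
Qed.

End PovmMeasure.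

Section Relativization.
Context {R : realType} {Gm M : ptopologicalType} {G : groupoid Gm M} {S : gsystem R G}.
Hypothesis Gm_hausdorff : hausdorff_space Gm.
Let H := sys_field S.
Let V := sys_rep S.
Variable A : op_field H.
Arguments A : clear implicits.
Hypothesis Auw : uw_continuous A.

Let sH (x : M) : separable_hilbert (H := H x) := @fiber_separable _ _ H x.
Let mfib (x : M) : measurable (tfiber G x : set (borel Gm)) := tfiber_borel (G := G) Gm_hausdorff x.

Lemma conjugate_bounded b : bounded_op (V b \o A (src G b) \o adjoint (V b)).
Proof.
have [Ab _] := uw_continuous_bounded Auw; have Vu := urep_unitary V b.
apply: bounded_comp; last exact: unitary_adjoint_bounded.
by apply: bounded_comp; first exact: unitary_bounded.
Qed.

Lemma integrand_continuous x (v w : forall y, H y) b0 : tfiber G x b0 ->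
  integrand A v w @ within (tfiber G x) (nbhs b0) --> integrand A v w b0.
Proof. by move=> xb0; apply: integrand_cvg => //; exact: section_approx_fiber. Qed.

Definition trace_integrand (chi : op_field H) (b : Gm) : R[i] :=
  trace (chi (tgt G b) \o (V b \o A (src G b) \o adjoint (V b))).

Lemma trace_integrand_ketbra (v w : forall y, H y) b :
  trace_integrand (fun y => ketbra (w y) (v y)) b = integrand A v w b.
Proof.
rewrite /trace_integrand integrandE.
by have [-> _] := ketbra_mul (w (tgt G b)) (v (tgt G b)) (@sH (tgt G b)) (conjugate_bounded b).
Qed.

Section TraceIntegrand.
Variables (x : M) (chi : op_field H) (a b : nat -> forall y, H y) (B C : R).
Arguments chi : clear implicits.
Hypotheses (chin : nuclear (a ^~ x) (b ^~ x) B (chi x))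
  (C0 : 0 <= C) (AC : forall y v, nm (A y v) <= C * nm v).

Let beta k := C * (nm (a k x) * nm (b k x)).

Let beta_le n : \sum_(k < n) beta k <= C * B.
Proof. by rewrite /beta -mulr_sumr ler_wpM2l //; case: chin => + _; exact. Qed.

Let integrand_beta k g : tfiber G x g -> nm (integrand A (b k) (a k) g) <= beta k.
Proof.
move=> xg; apply: le_trans (integrand_le _ _ _ C0 AC) _.
by rewrite xg /beta [nm (b k x) * _]mulrC.
Qed.

Lemma trace_integrand_series g : tfiber G x g ->
  series (fun k => integrand A (b k) (a k) g) @ \oo --> trace_integrand chi g.
Proof.
move=> xg; rewrite (funext (fun k => integrandE A (b k) (a k) g)).
have : nuclear (a ^~ (tgt G g)) (b ^~ (tgt G g)) B (chi (tgt G g)) by rewrite xg.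
by move=> /(nuclear_mul (@sH _)) /(_ (conjugate_bounded g)) [].
Qed.

Lemma trace_integrand_le g : tfiber G x g -> nm (trace_integrand chi g) <= C * B.
Proof.
move=> xg; apply: nm_cvg_le (trace_integrand_series xg); apply: nearW => n.
rewrite /series /= big_mkord; apply: le_trans (nm_sum _) _.
by apply: le_trans (beta_le n); apply: ler_sum => k _; exact: integrand_beta.
Qed.

Lemma trace_integrand_continuous g0 : tfiber G x g0 ->
  trace_integrand chi @ within (tfiber G x) (nbhs g0) --> trace_integrand chi g0.
Proof.
move=> xg0.
have FF : ProperFilter (within (tfiber G x) (nbhs g0)).
  by apply: within_nbhs_proper; exact: subset_closure.
have [||k|l [hl1 hl2]] := @tannery R Gm _ FF (fun g k => integrand A (b k) (a k) g)
  (fun k => integrand A (b k) (a k) g0) (trace_integrand chi) beta (C * B) beta_le.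
- by rewrite near_withinE; apply: nearW => g xg k; exact: integrand_beta.
- by rewrite near_withinE; apply: nearW => g xg; exact: trace_integrand_series.
- exact: integrand_continuous.
by rewrite (nm_cvg_unique (trace_integrand_series xg0) hl1).
Qed.

Lemma trace_integrand_cmeasurable : cmeasurable_on (tfiber G x) (trace_integrand chi).
Proof. by apply: within_cvg_cmeasurable => // g; exact: trace_integrand_continuous. Qed.

Section Integrals.
Variable m : {measure set (borel Gm) -> \bar R}.
Hypothesis mfin : (m (tfiber G x) < +oo)%E.

Lemma trace_integrand_integrable : cintegrable m (tfiber G x) (trace_integrand chi).
Proof.
apply: cbounded_integrable => //; first exact: trace_integrand_cmeasurable.
by exists (C * B) => g; exact: trace_integrand_le.
Qed.

Lemma trace_integrand_integral_series :
  series (fun k => cintegral m (tfiber G x) (integrand A (b k) (a k))) @ \oo -->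
    cintegral m (tfiber G x) (trace_integrand chi).
Proof.
apply: (@cintegral_series _ _ _ _ _ _ _ _ beta (C * B)) => //.
- by move=> k; apply: within_cvg_cmeasurable => // g; exact: integrand_continuous.
- exact: trace_integrand_cmeasurable.
- by move=> k; rewrite /beta !mulr_ge0 ?nm_ge0.
- exact: trace_integrand_series.
Qed.

End Integrals.
End TraceIntegrand.

Lemma trace_class_fields x (chi : op_field H) : trace_class (chi x) ->
  exists a b : nat -> forall y, H y, nuclear (a ^~ x) (b ^~ x) (fine (trnorm (chi x))) (chi x).
Proof.
move=> /(trace_class_nuclear (@sH x))[a [b ab]].
have [a' ha'] := choice (fun k => vector_field_extension (H := H) (a k)).
have [b' hb'] := choice (fun k => vector_field_extension (H := H) (b k)).
have ea : a' ^~ x = a by exact/funext.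
have eb : b' ^~ x = b by exact/funext.
by exists a', b'; rewrite ea eb.
Qed.

Lemma trace_integrand_unit x (chi : op_field H) :
  trace_integrand chi (gid G x) = trace (chi x \o A x).
Proof.
rewrite /trace_integrand; have := @urep_id _ _ _ _ _ V x.
(* The endpoints of [gid G x] equal [x] only propositionally. Generalizing them allows both
   equalities to be eliminated, after which [urep_id] says that [U] is the identity. *)
move: (V (gid G x)) (esym (src_id G x)) (esym (tgt_id G x)).
move: (src G (gid G x)) (tgt G (gid G x)) => p q U ep eq.
case: p / ep U; case: q / eq => U /= Uid.
have -> : U = id by apply/funext.
by congr trace; apply/funext => v /=; rewrite (@adjoint_eq _ _ _ id id).
Qed.

Lemma integrand_fiber x (v v' w w' : forall y, H y) g : tfiber G x g ->
  v x = v' x -> w x = w' x -> integrand A v w g = integrand A v' w' g.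
Proof.
move=> xg vx wx; rewrite /integrand /pullback.
suff loc (u u' : forall y, H y) : u x = u' x -> u (tgt G g) = u' (tgt G g).
  by rewrite (loc _ _ vx) (loc _ _ wx).
by rewrite xg.
Qed.

(** The integrals of matrix coefficients form a bounded sesquilinear form, represented by Riesz; the
    nuclear expansion then extends the identity from rank-one operators to all trace-class ones. *)
Lemma relativization_exists x (m : {measure set (borel Gm) -> \bar R}) :
  (m (tfiber G x) < +oo)%E -> exists T, is_relativization A m (T : H x -> H x).
Proof.
move=> mfin; have [Ab [C C0 AC]] := uw_continuous_bounded Auw.
have eB := chosen_basisP (@sH x).
(* [ext] is an arbitrary choice and need not be linear; [pbL] recovers linearity of the pullback on
   the target fibre, where only values at [x] enter. *)
have [ext extx] := choice (vector_field_extension (H := H) (x := x)).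
pose B v w := cintegral m (tfiber G x) (integrand A (ext v) (ext w)).
have int v w : cintegrable m (tfiber G x) (integrand A (ext v) (ext w)).
  apply: cbounded_integrable => //.
    by apply: within_cvg_cmeasurable => // g; exact: integrand_continuous.
  exists (C * (nm v * nm w)) => g xg; apply: le_trans (integrand_le _ _ _ C0 AC) _.
  by rewrite xg !extx.
pose K := 2 * (C * fine (m (tfiber G x))).
have K0 : 0 <= K by rewrite !mulr_ge0 // fine_ge0.
have Bbound v w : nm (B v w) <= K * (nm v * nm w).
  apply: le_trans (cintegral_bound (mfib x) _ (int v w) (c := C * (nm v * nm w)) _) _ => //.
    move=> g xg; apply: le_trans (integrand_le _ _ _ C0 AC) _.
    by rewrite xg !extx.
  by rewrite le_eqVlt; apply/orP; left; apply/eqP; rewrite /K; ring.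
have pb (v : H x) g (e : x = tgt G g) :
    pullback (ext v) g = adjoint (V g) (transport e v).
  rewrite /pullback; congr (adjoint _ _).
  by case: (tgt G g) / e.
have trL y (e : x = y) c (u v : H x) :
    transport e (c *: u + v) = c *: transport e u + transport e v.
  by case: y / e.
have pbL c u v g : tfiber G x g ->
    pullback (ext (c *: u + v)) g = c *: pullback (ext u) g + pullback (ext v) g.
  move=> xg; rewrite !(pb _ g (esym xg)) trL.
  by rewrite (unitary_adjoint_linear (urep_unitary V g)).
have Bl c u v w : B (c *: u + v) w = (c^*)%C * B u w + B v w.
  rewrite /B -cintegralZ // -cintegralD //; last exact: cintegrableZ.
  by apply: eq_cintegral => g xg; rewrite /integrand pbL // innerDl innerZl.
have Br c u v w : B w (c *: u + v) = c * B w u + B w v.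
  rewrite /B -cintegralZ // -cintegralD //; last exact: cintegrableZ.
  apply: eq_cintegral => g xg; have [AL _] := Ab (src G g).
  by rewrite /integrand pbL // AL innerDr innerZr.
have /choice[T hT] : forall w, exists u, forall v, inner v u = B v w.
  move=> w; apply: (riesz (C := K * nm w) eB); first by move=> c u v; exact: Bl.
  by move=> v; rewrite -mulrA [nm w * _]mulrC.
have Tb : bounded_op T.
  apply/bounded_opP; split.
    move=> c u v; apply: inner_inj => z.
    by rewrite innerDr innerZr !hT Br.
  exists K => // v; apply: nm_le_sqr; first by rewrite mulr_ge0 ?nm_ge0.
  rewrite -Re_inner_diag hT; apply: le_trans (le_trans (ler_norm _) (Re_le_nm _)) _.
  by apply: le_trans (Bbound _ _) _; rewrite [nm (T v) * _]mulrC mulrA.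
exists T; split=> // chi chitc f; have [a [b ab]] := trace_class_fields chitc.
split; first exact: (trace_integrand_integrable ab C0 AC).
have [h1 _] := nuclear_mul (@sH x) ab Tb.
apply: (nm_cvg_unique h1).
have h2 := trace_integrand_integral_series ab C0 AC mfin.
have -> : (fun k => inner (b k x) (T (a k x))) =
   (fun k => cintegral m (tfiber G x) (integrand A (b k) (a k))); last exact: h2.
apply/funext => k; rewrite hT; apply: eq_cintegral => g xg.
exact: (integrand_fiber xg).
Qed.

Lemma relativization_inner x (m : {measure set (borel Gm) -> \bar R})
    (T : H x -> H x) (v w : forall y, H y) :
  is_relativization A m T ->
  cintegrable m (tfiber G x) (integrand A v w) /\
  inner (v x) (T (w x)) = cintegral m (tfiber G x) (integrand A v w).
Proof.
move=> [Tb /(_ (fun y => ketbra (w y) (v y)) (ketbra_trace_class _ _ (@sH x)))] [hi].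
have [-> _] := ketbra_mul (w x) (v x) (@sH x) Tb; move=> ->.
split.
  by apply: (eq_cintegrable (mfib x) _ hi) => g _; exact: trace_integrand_ketbra.
by apply: eq_cintegral => g _; exact: trace_integrand_ketbra.
Qed.

(** The factor 2 is inherited from [cintegral_bound]. What matters is that the bound depends neither
    on [x] nor on the state. *)
Lemma relativization_bound x (m : {measure set (borel Gm) -> \bar R}) (T : H x -> H x) (C : R) :
  0 <= C -> (forall y v, nm (A y v) <= C * nm v) ->
  m (tfiber G x) = 1%E -> is_relativization A m T -> forall v, nm (T v) <= 2 * C * nm v.
Proof.
move=> C0 AC m1 Tm v; apply: nm_le_sqr; first by rewrite !mulr_ge0 ?nm_ge0.
have [v' v'x] := vector_field_extension (H := H) v.
have [w' w'x] := vector_field_extension (H := H) (T v).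
have [hi] := relativization_inner w' v' Tm; rewrite v'x w'x => hE.
rewrite -Re_inner_diag hE; apply: le_trans (le_trans (ler_norm _) (Re_le_nm _)) _.
have := cintegral_bound (c := C * (nm (T v) * nm v)) (mfib x) _ hi _.
rewrite m1 /= mulr1 [nm (T v) * nm v]mulrC !mulrA; apply; first exact: ltry.
move=> g xg; apply: le_trans (integrand_le _ _ _ C0 AC) _.
by rewrite xg v'x w'x -mulrA [nm v * _]mulrC.
Qed.

End Relativization.

(** * Localization at a unit arrow *)

Section Localization.
Context {R : realType} {Gm M : ptopologicalType} {G : groupoid Gm M}.
Context {F : qrf R G} {S : gsystem R G}.
Hypothesis Gm_hausdorff : hausdorff_space Gm.
Let H := sys_field S.
Variable A : op_field H.
Arguments A : clear implicits.
Hypothesis Auw : uw_continuous A.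

Lemma relativizationP (w : op_field (qrf_field F)) x : density (w x) ->
  is_relativization A (povm_measure (w x)) (relativization w A x).
Proof.
move=> wd.
have [|T hT] := relativization_exists Gm_hausdorff Auw (x := x)
  (m := povm_measure (w x)).
  by rewrite povm_measure_fiber // ltry.
exact: (@xgetI _ (fun=> 0) (is_relativization A (povm_measure (w x))) T).
Qed.

Lemma relativization_bounded (w : op_field (qrf_field F)) x :
  bounded_op (relativization w A x).
Proof.
rewrite /relativization; case: xgetP => [T _ []//|_]; exact: zero_bounded.
Qed.

Lemma relativization_cvg (w : nat -> op_field (qrf_field F)) x (chi : op_field H) :
  (forall n, density (w n x)) -> centred_at (fun n => w n x) (gid G x) ->
  trace_class (chi x) ->
  (fun n => trace (chi x \o relativization (w n) A x)) @ \oo --> trace (chi x \o A x).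
Proof.
move=> wd wc chitc.
have [Ab [C C0 AC]] := uw_continuous_bounded Auw.
have [a [b ab]] := trace_class_fields chitc.
have fc := trace_integrand_continuous Auw ab C0 AC.
have fb := trace_integrand_le Auw ab C0 AC.
have [fmr fmi] := trace_integrand_cmeasurable Gm_hausdorff Auw ab C0 AC.
have xx : tfiber G x (gid G x) by rewrite /tfiber /= tgt_id.
have mfib : measurable (tfiber G x : set (borel Gm)) := tfiber_borel (G := G) Gm_hausdorff x.
have dirac1 (f : Gm -> R) : measurable_fun (tfiber G x : set (borel Gm)) f ->
    \int[\d_(gid G x : borel Gm)]_(g in tfiber G x) f g = f (gid G x).
  move=> mf; rewrite /Rintegral integral_dirac //; last exact/measurable_EFinP.
  by rewrite diracE mem_set // mul1e.
rewrite -(trace_integrand_unit A x chi).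
have -> : (fun n => trace (chi x \o relativization (w n) A x)) =
  (fun n => cintegral (povm_measure (w n x)) (tfiber G x) (trace_integrand A chi)).
  by apply/funext => n; have [_ /(_ chi chitc)[]] := relativizationP (wd n).
apply: cvg_ReIm => /=.
- rewrite -(dirac1 _ fmr); apply: wc.
    by apply/subspace_continuousP => g xg; apply: cvg_Re; exact: fc.
  by exists (C * fine (trnorm (chi x))) => g xg; exact: le_trans (Re_le_nm _) (fb _ xg).
- rewrite -(dirac1 _ fmi); apply: wc.
    by apply/subspace_continuousP => g xg; apply: cvg_Im; exact: fc.
  by exists (C * fine (trnorm (chi x))) => g xg; exact: le_trans (Im_le_nm _) (fb _ xg).
Qed.

Lemma relativization_uw_cvg (w : nat -> op_field (qrf_field F)) x :
  (forall n, density (w n x)) -> centred_at (fun n => w n x) (gid G x) ->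
  op_uw_cvg (fun n => relativization (w n) A x) (A x).
Proof.
move=> wd wc; have [Ab _] := uw_continuous_bounded Auw.
split=> // [n|chi chitc]; first exact: relativization_bounded.
(* A relativization is tested by fields, so the single operator [chi] is extended by 0 to the other
   fibres. *)
pose chi' : op_field H := fun y =>
  if pselect (x = y) is left e then eq_rect x (fun z => H z -> H z) chi y e else fun=> 0.
have chix : chi' x = chi.
  by rewrite /chi'; case: pselect => // e; rewrite (Prop_irrelevance e erefl).
by rewrite -chix; apply: relativization_cvg => //; rewrite chix.
Qed.

End Localization.

(** * Measurability and the almost everywhere statement *)

Lemma cvg_ext (T : Type) (U : topologicalType) (F : set_system T) (f g : T -> U) (l : U) :
  (forall t, f t = g t) -> f @ F --> l -> g @ F --> l.
Proof. by move=> /funext ->. Qed.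

Lemma cmeasurableD (R : realType) (X : ptopologicalType) (f g : X -> R[i]) :
  cmeasurable f -> cmeasurable g -> cmeasurable (fun y => f y + g y).
Proof. exact: cmeasurable_onD. Qed.

Lemma cmeasurableM (R : realType) (X : ptopologicalType) (f g : X -> R[i]) :
  cmeasurable f -> cmeasurable g -> cmeasurable (fun y => f y * g y).
Proof. exact: cmeasurable_onM. Qed.

Lemma cmeasurable_cst (R : realType) (X : ptopologicalType) (c : R[i]) :
  cmeasurable (fun _ : X => c).
Proof. exact: cmeasurable_on_cst. Qed.

Lemma cmeasurableJ (R : realType) (X : ptopologicalType) (f : X -> R[i]) :
  cmeasurable f -> cmeasurable (fun y => (f y)^*%C).
Proof.
move=> [fr fi]; split.
- by rewrite (_ : (fun y => _) = fun y => complex.Re (f y)) //; apply/funext => y; case: (f y).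
- rewrite (_ : (fun y => _) = fun y => - complex.Im (f y)); last by apply/funext => y; case: (f y).
  exact: measurable_funN.
Qed.

Lemma cmeasurable_sum (R : realType) (X : ptopologicalType) (I : Type) (r : seq I)
    (f : I -> X -> R[i]) :
  (forall i, cmeasurable (f i)) -> cmeasurable (fun y => \sum_(i <- r) f i y).
Proof.
move=> fm; elim: r => [|i r IH].
  by under eq_fun do rewrite big_nil; exact: cmeasurable_cst.
by under eq_fun do rewrite big_cons; apply: cmeasurableD.
Qed.

Lemma cmeasurable_cvg (R : realType) (X : ptopologicalType) (g : nat -> X -> R[i]) (f : X -> R[i]) :
  (forall n, cmeasurable (g n)) -> (forall y, g ^~ y @ \oo --> f y) -> cmeasurable f.
Proof. by move=> gm gf; apply: cmeasurable_on_cvg gm _ => y _; exact: gf. Qed.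

Lemma continuous_cmeasurable (R : realType) (X : ptopologicalType) (f : X -> R[i]) :
  continuous f -> cmeasurable f.
Proof.
move=> fc; apply: within_cvg_cmeasurable; first exact: measurableT.
by move=> y _; apply: cvg_within_filter; exact: fc.
Qed.

(** * Measurable orthonormal bases and traces *)

Section MeasurableFields.
Context {R : realType} {M : ptopologicalType} {H : hfield R M}.
Variable zeta : nat -> forall x, H x.
Hypothesis zeta_section : forall k, csection (zeta k).
Hypothesis zeta_total : forall x (v : H x) (e : R), 0 < e ->
  exists (n : nat) (c : 'I_n -> R[i]), `|v - \sum_(k < n) c k *: zeta k x| <= (e%:C)%C.

(** Normalization divides by a norm that may vanish, so Gram-Schmidt leaves the continuous sections.
    It stays within combinations of [zeta] with measurable coefficients, and induction on this class
    reduces matrix coefficients to those of [zeta]. *)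
Inductive measurable_combination : (forall x, H x) -> Prop :=
| combination_base k : measurable_combination (zeta k)
| combination_add v w : measurable_combination v -> measurable_combination w ->
    measurable_combination (fun x => v x + w x)
| combination_scale c v : cmeasurable c -> measurable_combination v ->
    measurable_combination (fun x => c x *: v x).

Lemma combination_inner (B : op_field H) v w : (forall x, linear (B x)) ->
  (forall i j, cmeasurable (fun x => inner (zeta i x) (B x (zeta j x)))) ->
  measurable_combination v -> measurable_combination w ->
  cmeasurable (fun x => inner (v x) (B x (w x))).
Proof.
move=> BL Bm vm wm; elim: vm => [i|u u' _ IHu _ IHu'|c u cm _ IH].
- elim: wm => [j|u u' _ IHu _ IHu'|c u cm _ IH]; first exact: Bm.
  + by under eq_fun do rewrite (linD (BL _)) innerDr; exact: cmeasurableD.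
  + by under eq_fun do rewrite (linZ (BL _)) innerZr; exact: cmeasurableM.
- by under eq_fun do rewrite innerDl; exact: cmeasurableD.
- by under eq_fun do rewrite innerZl; apply: cmeasurableM => //; exact: cmeasurableJ.
Qed.

Lemma combination_inner_id v w : measurable_combination v -> measurable_combination w ->
  cmeasurable (fun x => inner (v x) (w x)).
Proof.
apply: (@combination_inner (fun x => @id (H x))) => // i j.
by apply: continuous_cmeasurable; exact: csection_inner_continuous.
Qed.

(** Writes the normalizing factor as a power function, whose measurability is available; at [r = 0]
    both sides are 0. *)
Lemma inv_sqrt_powR (r : R) : 0 <= r -> (Num.sqrt r)^-1 = r `^ (- 2^-1).
Proof. by move=> r0; rewrite powRN powR12_sqrt. Qed.

Lemma combination_normalize v : measurable_combination v ->
  measurable_combination (fun x => psd_normalize inner (v x)).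
Proof.
move=> vm; apply: combination_scale => //; split => /=; last exact: measurable_cst.
under eq_fun do rewrite inv_sqrt_powR ?(psd_q_ge0 inner_psd) //.
have [vr _] := combination_inner_id vm vm.
exact: (measurableT_comp (measurable_powR _) vr).
Qed.

Definition gs_field n x : H x := gs inner (zeta ^~ x) n.

Lemma gs_residual_combination n v : measurable_combination v ->
  measurable_combination (fun x => gs_residual inner (zeta ^~ x) n (v x)).
Proof.
elim: n v => [//|n IH] v vm /=.
have fm := combination_normalize (IH _ (combination_base n)).
have cm := combination_inner_id fm vm.
have := combination_add (IH _ vm)
  (combination_scale (cmeasurableM (cmeasurable_cst _ (-1)) cm) fm).
congr measurable_combination; apply: functional_extensionality_dep => x.
by rewrite mulN1r scaleNr.
Qed.

Lemma gs_field_combination n : measurable_combination (gs_field n).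
Proof.
by apply: combination_normalize; apply: gs_residual_combination; exact: combination_base.
Qed.

Lemma gs_field_basis x : orthonormal_basis (gs_field ^~ x).
Proof.
apply: gs_basis => v e /(zeta_total v)[n [c h]].
by exists n, c; rewrite -lecR -norm_nm.
Qed.

Lemma cmeasurable_trace (A B : op_field H) :
  (forall x, bounded_op (A x)) -> (forall x, trace_class (B x)) ->
  (forall i j, cmeasurable (fun x => inner (zeta i x) (A x (zeta j x)))) ->
  (forall i j, cmeasurable (fun x => inner (zeta i x) (B x (zeta j x)))) ->
  cmeasurable (fun x => trace (A x \o B x)).
Proof.
move=> Ab Btc Am Bm.
have AL x : linear (A x) by case: (Ab x).
have BL x : linear (B x) by case: (Btc x) => -[].
have sH x : separable_hilbert (H := H x) := @fiber_separable _ _ H x.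
apply: (@cmeasurable_cvg _ _ (fun n x =>
  \sum_(i < n) inner (gs_field i x) (A x (B x (gs_field i x))))).
  move=> n; apply: cmeasurable_sum => i.
  (* Measurability is known only for the matrix coefficients of each factor, so a Parseval expansion
     is inserted between [A x] and [B x]. *)
  apply: (@cmeasurable_cvg _ _ (fun m x => \sum_(j < m)
    (inner (gs_field j x) (B x (gs_field i x)) * inner (gs_field i x) (A x (gs_field j x))))).
    move=> m; apply: cmeasurable_sum => j; apply: cmeasurableM;
      by apply: combination_inner => //; exact: gs_field_combination.
  move=> x; have h : (inner (gs_field i x) \o (A x \o series (fun j =>
      inner (gs_field j x) (B x (gs_field i x)) *: gs_field j x))) @ \oo -->
      inner (gs_field i x) (A x (B x (gs_field i x))).
    apply: cvg_inner; apply: bounded_cvg => //; apply: parseval; exact: gs_field_basis.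
  apply: cvg_ext h => m /=.
  rewrite /series /= big_mkord (lin_sum (AL x)) inner_sumr; apply: eq_bigr => j _.
  by rewrite (linZ (AL x)) innerZr.
move=> x; have [a [b ab]] := trace_class_nuclear (@sH x) (Btc x).
have [_ [C C0 AC]] := iffLR (bounded_opP _) (Ab x).
have [_ _ h] := trace_nuclear (@sH x) (nuclear_compl ab (Ab x) C0 AC).
apply: cvg_ext (h _ (gs_field_basis x)) => n.
by rewrite /series /= big_mkord.
Qed.

End MeasurableFields.

(** * Null sets and Borel representatives *)

Section NullSets.
Context {d : measure_display} {T : measurableType d} {R : realType}.
Variable mu : {measure set T -> \bar R}.
Local Open Scope ereal_scope.
Import HBNNSimple.

Lemma aeS (P Q : T -> Prop) : {ae mu, forall x, P x} ->
  (forall x, P x -> Q x) -> {ae mu, forall x, Q x}.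
Proof. by move=> h1 h; apply: filterS h1. Qed.

Lemma aeS2 (P1 P2 Q : T -> Prop) : {ae mu, forall x, P1 x} -> {ae mu, forall x, P2 x} ->
  (forall x, P1 x -> P2 x -> Q x) -> {ae mu, forall x, Q x}.
Proof. by move=> h1 h2 h; apply: filterS2 h1 h2. Qed.

Lemma aeS3 (P1 P2 P3 Q : T -> Prop) : {ae mu, forall x, P1 x} ->
  {ae mu, forall x, P2 x} -> {ae mu, forall x, P3 x} ->
  (forall x, P1 x -> P2 x -> P3 x -> Q x) -> {ae mu, forall x, Q x}.
Proof. by move=> h1 h2 h3 h; apply: filterS3 h1 h2 h3. Qed.

Lemma ae_all (P : nat -> T -> Prop) : (forall n, {ae mu, forall x, P n x}) ->
  {ae mu, forall x n, P n x}.
Proof. exact: ae_foralln. Qed.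

(* No measurability of f: the integral of a non-measurable nonnegative function is
   the supremum of the integrals of the simple functions below it. *)
Lemma ge0_integral_patch_null (N : set T) (f : T -> \bar R) : measurable N -> mu N = 0 ->
  (forall x, 0 <= f x) -> \int[mu]_x f x = \int[mu]_x (f \_ (~` N)) x.
Proof.
move=> mN N0 f0; have mNC := measurableC mN.
have g0 x : 0 <= (f \_ (~` N)) x by rewrite patchE; case: ifP.
rewrite (ge0_integralTE mu f0) (ge0_integralTE mu g0); apply/eqP; rewrite eq_le; apply/andP; split.
- apply: ge_ereal_sup => _ [h hf <-]; apply: ereal_sup_ubound.
  exists (proj_nnsfun h mNC) => [x|].
    rewrite -mrestrict !patchE; case: ifP => // _; exact: hf.
  rewrite -!integralT_nnsfun; apply: ge0_ae_eq_integral => //.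
  + exact/measurable_EFinP.
  + exact/measurable_EFinP.
  + by move=> x _; rewrite lee_fin.
  + by move=> x _; rewrite lee_fin.
  + have hE x : ~ N x -> proj_nnsfun h mNC x = h x.
      by move=> Nx; rewrite -mrestrict patchE mem_set.
    by exists N; split=> // x; apply: contra_notP => Nx _; rewrite hE.
- apply: ge_ereal_sup => _ [h hf <-]; apply: ereal_sup_ubound; exists h => // x.
  apply: le_trans (hf x) _; rewrite patchE; case: ifP => // _; exact: f0.
Qed.

(** Allows a function measurable only for the completion of [mu] to be replaced, under the integral,
    by a Borel representative. *)
Lemma integral_ae_eq (f g : T -> \bar R) : {ae mu, forall x, f x = g x} ->
  \int[mu]_x f x = \int[mu]_x g x.
Proof.
move=> [N [mN N0 sub]]; rewrite integralE [RHS]integralE.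
have fg x : (~` N) x -> f x = g x by move=> Nx; apply: contrapT => h; apply: Nx; exact: sub.
have fgp : (f ^\+) \_ (~` N) = (g ^\+) \_ (~` N).
  by apply/funext => x; rewrite !patchE; case: ifP => // /set_mem /fg; rewrite !funeposE => ->.
have fgn : (f ^\-) \_ (~` N) = (g ^\-) \_ (~` N).
  by apply/funext => x; rewrite !patchE; case: ifP => // /set_mem /fg; rewrite !funenegE => ->.
rewrite (ge0_integral_patch_null mN N0) // fgp -(ge0_integral_patch_null mN N0) //.
by rewrite (ge0_integral_patch_null mN N0 (funeneg_ge0 f)) // fgn -(ge0_integral_patch_null mN N0).
Qed.

End NullSets.

Section AeMeasurable.
Context {R : realType} {X : ptopologicalType}.
Variable mu : {measure set (borel X) -> \bar R}.
Implicit Types f g : X -> R[i].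

Lemma cintegral_ae_eq f g : {ae mu, forall x, f x = g x} ->
  cintegral mu setT f = cintegral mu setT g.
Proof.
move=> fg; congr Complex; rewrite /Rintegral; congr fine; apply: integral_ae_eq;
  by apply: (aeS fg) => x ->.
Qed.

Lemma cdominated_convergence (f_ : nat -> X -> R[i]) f (g : X -> R) :
  (forall n, ae_cmeasurable mu (f_ n)) -> ae_cmeasurable mu f ->
  mu.-integrable setT (EFin \o g) ->
  {ae mu, forall x, f_ ^~ x @ \oo --> f x} ->
  {ae mu, forall x n, nm (f_ n x) <= g x} ->
  (fun n => cintegral mu setT (f_ n)) @ \oo --> cintegral mu setT f.
Proof.
move=> /choice[h_ hP] [h [hm fh]] gi fc fb.
have fh_ : {ae mu, forall x n, f_ n x = h_ n x}.
  by apply: ae_all => n; case: (hP n).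
rewrite (cintegral_ae_eq fh).
have -> : (fun n => cintegral mu setT (f_ n)) = (fun n => cintegral mu setT (h_ n)).
  by apply/funext => n; apply: cintegral_ae_eq; case: (hP n).
have hc : {ae mu, forall x, h_ ^~ x @ \oo --> h x}.
  apply: (aeS3 fc fh_ fh) => x c e_ e; rewrite -e.
  by apply: cvg_ext c => n; exact: e_.
have hb : {ae mu, forall x n, nm (h_ n x) <= g x}.
  by apply: (aeS2 fb fh_) => x b e n; rewrite -e.
have real (r_ : nat -> X -> R) (r : X -> R) :
    (forall n, measurable_fun [set: borel X] (r_ n)) -> measurable_fun [set: borel X] r ->
    {ae mu, forall x, r_ ^~ x @ \oo --> r x} ->
    {ae mu, forall x n, `|r_ n x| <= g x} ->
    (fun n => \int[mu]_x r_ n x) @ \oo --> \int[mu]_x r x.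
  move=> rm_ rm rc rb.
  have rc' : {ae mu, forall x, setT x -> (fun n => (r_ n x)%:E) @ \oo --> (r x)%:E}.
    by apply: (aeS rc) => x c _; apply: cvg_EFin; first exact: nearW.
  have rb' : {ae mu, forall x n, setT x -> (`|(r_ n x)%:E| <= (g x)%:E)%E}.
    by apply: (aeS rb) => x b n _; rewrite abse_EFin lee_fin.
  have [ri _ rl] := @dominated_convergence _ (borel X) R mu setT measurableT
    (fun n x => (r_ n x)%:E) (EFin \o r) (EFin \o g)
    (fun n => iffRL (measurable_EFinP _ _) (rm_ n)) (iffRL (measurable_EFinP _ _) rm)
    rc' gi rb'.
  apply: fine_cvg; rewrite fineK //.
  exact: (integrable_fin_num measurableT ri).
apply: cvg_ReIm => /=.
- apply: real; [by move=> n; case: (hP n) => -[]|by case: hm| |].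
  + by apply: (aeS hc) => x c; exact: cvg_Re.
  + by apply: (aeS hb) => x b n; exact: le_trans (Re_le_nm _) (b n).
- apply: real; [by move=> n; case: (hP n) => -[]|by case: hm| |].
  + by apply: (aeS hc) => x c; exact: cvg_Im.
  + by apply: (aeS hb) => x b n; exact: le_trans (Im_le_nm _) (b n).
Qed.

End AeMeasurable.

Lemma integral_carried (d : measure_display) (T : measurableType d) (R : realType)
    (m : {measure set T -> \bar R}) (D : set T) (f : T -> \bar R) :
  measurable D -> m (~` D) = 0%E -> measurable_fun setT f ->
  (\int[m]_(x in D) f x = \int[m]_x f x)%E.
Proof.
move=> mD D0 mf; rewrite integralE [RHS]integralE; have mDC := measurableC mD.
have DE : D = setT `\` ~` D by rewrite setTD setCK.
by congr (_ - _)%E; [have mg := measurable_funepos mf | have mg := measurable_funeneg mf];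
  rewrite (ge0_negligible_integral mDC measurableT mg) // -DE.
Qed.

Section AeFields.
Context {R : realType} {M : ptopologicalType} {H : hfield R M}.
Variable mu : {measure set (borel M) -> \bar R}.
Implicit Types (A B : op_field H) (N : set M).

(** Vanishing on a null set turns almost everywhere properties into the pointwise ones that
    [cmeasurable_trace] asks for: 0 is trace class and has measurable coefficients. *)
Definition op_off N B : op_field H := fun x v => if x \in N then 0 else B x v.
Arguments op_off : clear implicits.

Lemma op_off_in N B x : N x -> op_off N B x = fun=> 0.
Proof. by move=> Nx; apply/funext => v; rewrite /op_off mem_set. Qed.

Lemma op_off_notin N B x : ~ N x -> op_off N B x = B x.
Proof. by move=> Nx; apply/funext => v; rewrite /op_off memNset. Qed.

Lemma cmeasurable_off N (f : M -> R[i]) : measurable (N : set (borel M)) -> cmeasurable f ->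
  cmeasurable (fun x => if x \in N then 0 else f x).
Proof.
move=> mN [fr fi]; have mC := measurableC mN.
have E (h : M -> R) : measurable_fun [set: borel M] h ->
    measurable_fun [set: borel M] (fun x => if x \in N then 0 else h x).
  move=> mh; rewrite (_ : (fun x => _) = (fun x => \1_(~` N) x * h x)).
    by apply: measurable_funM => //; exact: measurable_indic.
  by apply/funext => x; rewrite indicE in_setC; case: (x \in N); rewrite ?mul0r ?mul1r.
split.
- by rewrite (_ : (fun x => _) = (fun x => if x \in N then 0 else complex.Re (f x)));
    [exact: E | apply/funext => x; case: ifP].
- by rewrite (_ : (fun x => _) = (fun x => if x \in N then 0 else complex.Im (f x)));
    [exact: E | apply/funext => x; case: ifP].
Qed.

(** Only countably many pairs of sections are involved, so their exceptional sets, together with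
    that of [P], fit into one Borel null set. *)
Lemma ae_measurable_off (zeta : nat -> forall x, H x) (P : M -> Prop) B :
  (forall k, csection (zeta k)) -> ae_measurable_op_field mu B -> {ae mu, forall x, P x} ->
  exists N, [/\ measurable (N : set (borel M)), mu N = 0%E, forall x, ~ N x -> P x
    & forall i j, cmeasurable (fun x => inner (zeta i x) (op_off N B x (zeta j x)))].
Proof.
move=> cz Bm PE.
have /choice[g gP] : forall ij : nat * nat, exists g, cmeasurable g /\
    {ae mu, forall x, inner (zeta ij.1 x) (B x (zeta ij.2 x)) = g x}.
  by move=> ij; exact: Bm.
have gEi i : {ae mu, forall x j, inner (zeta i x) (B x (zeta j x)) = g (i, j) x}.
  by apply: ae_all => j; case: (gP (i, j)).
have gE := ae_all gEi.
have [N [mN N0 sub]] := aeS2 PE gE (fun x p q => conj p q).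
have off x : ~ N x -> P x /\ forall i j, inner (zeta i x) (B x (zeta j x)) = g (i, j) x.
  by move=> Nx; apply: contrapT => h; apply: Nx; exact: sub.
exists N; split=> // [x /off[]//|i j].
have [gm _] := gP (i, j).
rewrite (_ : (fun x => _) = (fun x => if x \in N then 0 else g (i, j) x)).
  exact: cmeasurable_off.
apply/funext => x; have [Nx|Nx] := pselect (N x).
  by rewrite op_off_in // mem_set // inner0r.
by rewrite op_off_notin // memNset //; have [_ ->] := off x Nx.
Qed.

Lemma ae_cmeasurable_trace A B : (forall x, bounded_op (A x)) -> (forall x, trace_class (B x)) ->
  ae_measurable_op_field mu A -> ae_measurable_op_field mu B ->
  ae_cmeasurable mu (fun x => trace (A x \o B x)).
Proof.
move=> Ab Btc Am Bm; have [zeta [cz tz]] := hfield_fundamental H.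
have triv : {ae mu, forall x : M, True} by apply: aeW.
have [N [mN N0 _ AN]] := ae_measurable_off cz Am triv.
have [N' [mN' N0' _ BN]] := ae_measurable_off cz Bm triv.
exists (fun x => trace (op_off N A x \o op_off N' B x)); split.
  apply: (cmeasurable_trace cz tz) => // x.
  - have [Nx|Nx] := pselect (N x); last by rewrite op_off_notin.
    by rewrite op_off_in //; exact: zero_bounded.
  - have [Nx|Nx] := pselect (N' x); last by rewrite op_off_notin.
    by rewrite op_off_in //; exact: zero_trace_class.
exists (N `|` N'); split; first exact: measurableU.
  by rewrite null_set_setU.
move=> x; apply: contra_notP => /not_orP[Nx Nx'].
by rewrite /= !op_off_notin.
Qed.

Lemma measurable_op_field_ae A : measurable_op_field A -> ae_measurable_op_field mu A.
Proof.
move=> Am xi eta cx ce; exists (fun x => inner (xi x) (A x (eta x))); split.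
  exact: Am.
exact: aeW.
Qed.

End AeFields.
Arguments op_off {R M H} N B x _.

(** * The POVM kernel and convergence against the predual *)

Section Kernel.
Context {R : realType} {Gm M : ptopologicalType} {G : groupoid Gm M}.
Context {F : qrf R G} {S : gsystem R G}.
Hypothesis Gm_hausdorff : hausdorff_space Gm.
Variable mu : {measure set (borel M) -> \bar R}.

Lemma trace_zero (K : hilbertType R) : separable_hilbert (H := K) ->
  trace (fun _ : K => 0 : K) = 0.
Proof. by move=> sK; rewrite -(ketbra_zerol K 0) trace_ketbra // inner0r. Qed.

(** The state is a measurable density field only off a null set. Putting the zero measure there
    yields a genuine Borel kernel, against which functions on [Gm] can be integrated measurably in
    [x]. *)
Lemma povm_kernel (w : op_field (qrf_field F)) : vn_states mu w ->
  exists (N : set M) (l : M -> {measure set (borel Gm) -> \bar R}),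
    [/\ measurable (N : set (borel M)), mu N = 0%E,
      forall x, ~ N x -> density (w x) /\ l x = povm_measure (w x)
    & forall U : set (borel Gm), measurable U ->
        measurable_fun [set: borel M] (fun x => l x U)].
Proof.
move=> [[wb wm _] wd]; have [zeta [cz tz]] := hfield_fundamental (qrf_field F).
have [N [mN N0 NP Nm]] := ae_measurable_off cz wm wd.
pose l x : {measure set (borel Gm) -> \bar R} :=
  if x \in N then (mzero : {measure set (borel Gm) -> \bar R}) else povm_measure (w x).
exists N, l; split=> //; rewrite /l.
  by move=> x Nx; split; [exact: NP | rewrite memNset].
move=> U mU.
pose E x := qrf_povm F x (U `&` tfiber G x).
rewrite (_ : (fun x => _) = (fun x => (complex.Re (trace (E x \o op_off N w x)))%:E)).
  have [h _] : cmeasurable (fun x => trace (E x \o op_off N w x)).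
    apply: (cmeasurable_trace cz tz) => // [x|x|i j].
    - exact: povm_bounded.
    - have [Nx|Nx] := pselect (N x); first by rewrite op_off_in //; exact: zero_trace_class.
      by rewrite op_off_notin //; have [] := NP x Nx.
    - exact: povm_measurable.
  exact/measurable_EFinP.
apply/funext => x.
have sH := @fiber_separable _ _ (qrf_field F) x.
have Eb : bounded_op (E x) by exact: povm_bounded.
have [Nx|Nx] := pselect (N x).
  rewrite mem_set // op_off_in // (_ : E x \o _ = fun=> 0) ?trace_zero //.
  by apply/funext => v /=; case: Eb => EL _; rewrite (lin0 EL).
have wxd := NP x Nx; rewrite memNset // op_off_notin // povm_measureP //.
have [b bn] := density_nuclear sH wxd.
by have [_ ->] := nuclear_mul sH bn Eb.
Qed.

Let H := sys_field S.
Variable A : op_field H.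
Arguments A : clear implicits.
Hypothesis Auw : uw_continuous A.

Lemma integrand_section_cmeasurable (xi eta : forall x, H x) : csection xi -> csection eta ->
  cmeasurable (integrand A xi eta).
Proof.
move=> cx ce; apply: within_cvg_cmeasurable; first exact: measurableT.
by move=> b _; apply: integrand_cvg => //; exact: section_approx_csection.
Qed.

Lemma relativization_measurable (w : op_field (qrf_field F)) : vn_states mu w ->
  ae_measurable_op_field mu (relativization w A).
Proof.
move=> wS xi eta cx ce; have [N [l [mN N0 lP lm]]] := povm_kernel wS.
have [hr hi] := integrand_section_cmeasurable cx ce.
have int_meas (h : Gm -> R) : measurable_fun [set: borel Gm] h ->
    measurable_fun [set: borel M] (fun x => \int[l x]_y h y).
  move=> mh; have mE : measurable_fun [set: borel Gm] (EFin \o h) by exact/measurable_EFinP.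
  suff : measurable_fun [set: borel M] (fun x => \int[l x]_y (h y)%:E)%E.
    exact: (measurableT_comp (fine_measurable _)).
  (* Integration against a kernel is measurable for nonnegative functions, hence the two parts. *)
  rewrite (funext (fun x => integralE (l x) setT (EFin \o h))).
  apply: emeasurable_funB.
  - by apply: measurable_fun_integral_kernel => //; exact: measurable_funepos.
  - by apply: measurable_fun_integral_kernel => //; exact: measurable_funeneg.
exists (fun x => cintegral (l x) setT (integrand A xi eta)); split.
  by split; exact: int_meas.
(* Off [N] the kernel is the POVM measure, carried by the target fibre of [x]; integrating over all
   of [Gm] therefore gives the matrix coefficient of the relativization. *)
exists N; split=> // x; apply: contra_notP => Nx /=.
have [wxd ->] := lP x Nx.
have [_ ->] := relativization_inner Gm_hausdorff Auw xi eta (relativizationP Gm_hausdorff Auw wxd).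
have mf : measurable (tfiber G x : set (borel Gm)) := tfiber_borel (G := G) Gm_hausdorff x.
have out := povm_measure_outside Gm_hausdorff wxd.
congr Complex; rewrite /Rintegral; congr fine; apply: integral_carried => //;
  exact/measurable_EFinP.
Qed.

Lemma relativization_vn (w : op_field (qrf_field F)) : vn_states mu w ->
  vn_algebra mu (relativization w A).
Proof.
move=> wS; split.
- by move=> x; exact: relativization_bounded.
- exact: relativization_measurable.
have [_ [C C0 AC]] := uw_continuous_bounded Auw; have [_ wd] := wS.
exists (2 * C); apply: (aeS wd) => x wxd; apply/op_bounded_nm.
apply: (relativization_bound Gm_hausdorff Auw C0 AC _ (relativizationP Gm_hausdorff Auw wxd)).
exact: povm_measure_fiber.
Qed.

Lemma uw_continuous_vn : vn_algebra mu A.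
Proof.
have [Ab [C C0 AC]] := uw_continuous_bounded Auw; split=> //.
  apply: measurable_op_field_ae => xi eta cx ce; apply: continuous_cmeasurable.
  exact: uw_continuous_inner.
by exists C; apply: aeW => x; exact/op_bounded_nm.
Qed.

Lemma relativization_vn_cvg (w : nat -> op_field (qrf_field F)) :
  (forall n, vn_states mu (w n)) ->
  {ae mu, forall x, centred_at (fun n => w n x) (gid G x)} ->
  vn_uw_cvg mu (fun n => relativization (w n) A) A.
Proof.
move=> wS wc; split=> [n||chi [chitc chim [g [gi gE]]]].
- exact: relativization_vn.
- exact: uw_continuous_vn.
have wd : {ae mu, forall x n, density (w n x)} by apply: ae_all => n; case: (wS n).
have [Ab [C C0 AC]] := uw_continuous_bounded Auw.
have sH x : separable_hilbert (H := H x) := @fiber_separable _ _ H x.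
(* The predual pairing has [chi x] on the right, the pointwise statement on the left; cyclicity
   reconciles them. *)
have swap x (X : H x -> H x) : bounded_op X -> trace (X \o chi x) = trace (chi x \o X).
  move=> Xb; have [a [b ab]] := trace_class_nuclear (@sH x) (chitc x).
  by have [_ ->] := nuclear_mul (@sH x) ab Xb.
(* The dominating function is the uniform operator bound [2 * C] times [g], which is almost
   everywhere the trace norm of [chi x]. *)
apply: (@cdominated_convergence _ _ _ _ _ (fun x => 2 * C * g x)).
- move=> n; apply: ae_cmeasurable_trace => //; first by move=> x; exact: relativization_bounded.
  exact: relativization_measurable.
- by apply: ae_cmeasurable_trace => //; case: uw_continuous_vn.
- exact: (eq_integrable measurableT _ _ _ (integrableZl measurableT (2 * C) gi)).
- apply: (aeS2 wd wc) => x wxd wxc; rewrite swap //.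
  apply: cvg_ext (relativization_cvg Gm_hausdorff Auw wxd wxc (chitc x)) => n.
  by rewrite swap //; exact: relativization_bounded.
- apply: (aeS2 wd gE) => x wxd gx n; rewrite swap; last exact: relativization_bounded.
  have [a [b ab]] := trace_class_nuclear (@sH x) (chitc x).
  rewrite gx /= in ab; apply: (nuclear_mul_le (@sH x) ab); first exact: relativization_bounded.
  + exact: mulr_ge0.
  + apply: (relativization_bound Gm_hausdorff Auw C0 AC _
      (relativizationP Gm_hausdorff Auw (wxd n))).
    exact: povm_measure_fiber.
Qed.

End Kernel.

Unset Implicit Arguments.

Theorem theorem4p36 (R : realType) (Gm M : ptopologicalType)
  (G : groupoid Gm M)
  (Gm_second_countable : @second_countable Gm)
  (Gm_hausdorff : hausdorff_space Gm)
  (nu : M -> {measure set (borel Gm) -> \bar R})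
  (nu_haar : haar_system G nu)
  (mu : {measure set (borel M) -> \bar R})
  (mu_radon : radon_on setT mu)
  (mu_sigma_finite : sigma_finite setT mu)
  (mu_quasi_invariant : quasi_invariant G nu mu)
  (tfiber_metrizable : forall x : M, metrizable_on R (tfiber G x))
  (F : qrf R G)
  (F_localizable : localizable F)
  (F_admissible : admissible mu F)
  (S : gsystem R G) :
  (forall (x : M) (w : nat -> op_field (qrf_field F)),
     povm_support F x (gid G x) ->
     (forall n, vn_states mu (w n)) ->
     localizing_sequence (fun n => w n x) (gid G x) ->
     forall A : op_field (sys_field S), uw_continuous A ->
       op_uw_cvg (fun n => relativization (w n) A x) (A x)) /\
  (forall w : nat -> op_field (qrf_field F),
     (forall n, vn_states mu (w n)) ->
     {ae mu, forall x, centred_at (fun n => w n x) (gid G x)} ->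
     forall A : op_field (sys_field S), uw_continuous A ->
       vn_uw_cvg mu (fun n => relativization (w n) A) A).
Proof.
split=> [x w _ _ [wd wc] A Auw|w wS wc A Auw].
  exact: relativization_uw_cvg.
exact: relativization_vn_cvg.
Qed.
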